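(* Let $g\ge1$, let $X=X_{P,Q}$ be a hyperelliptic curve of genus $g$ over an algebraically closed field $k$ with affine model $y^2+Q(x)y=P(x)$, embedded in its jacobian $J$ with the point at infinity as base point. Let $N\geq 2g+1$ and let $r\in\{0,1,\dots,2g-2\}$. Define $$\varepsilon_{r,g}=\left(g-\left\lfloor\frac{r+1}{2}\right\rfloor\right)\left(\left\lfloor\frac r2\right\rfloor+1\right).$$ Then $\tilde U_N(x)^{\varepsilon_{r,g}}$ divides $\varDelta_{N+r}(x)$ in $k[x]$.
   Context: Curve: $k$ is algebraically closed of arbitrary characteristic; $P\in k[x]$ is monic of degree $2g+1$, $Q\in k[x]$ has degree at most $g$, and the affine curve $y^2+Q(x)y=P(x)$ is smooth; $X$ is its smooth projective completion, obtained by adding one point $\infty$, of genus $g$. $X$ is viewed as a subset of its jacobian $J$ via $\xi\mapsto$ class of $[\xi]-[\infty]$. $J[N]$ is the subgroup of $J(k)$ of points of order dividing $N$ and $\tilde J[N]=J[N]\setminus J[2]$. Let $\tilde{\mathcal T}_N$ be the set of $x_0\in k$ such that the points $(x_0,y_0)$ and $(x_0,-Q(x_0)-y_0)$ of $X$ with $x$-coordinate $x_0$ lie in $\tilde J[N]$ (one lies in it iff the other does), and $\tilde U_N(x)=\prod_{x_0\in\tilde{\mathcal T}_N}(x-x_0)$. Definition of $\varDelta_N(x)\in k[x]$ for any $N\ge 2g+1$: let $\Lambda=\mathbb Z[p_0,\dots,p_{2g},q_0,\dots,q_g]$ (polynomial ring), $\mathsf P(\mathsf x)=p_0+p_1\mathsf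 x+\cdots+p_{2g}\mathsf x^{2g}+\mathsf x^{2g+1}$, $\mathsf Q(\mathsf x)=q_0+\cdots+q_g\mathsf x^g$, $\mathsf F=4\mathsf P+\mathsf Q^2$. Consider $\Lambda[\mathsf x,\mathsf y]$ with $\mathsf y^2+\mathsf Q(\mathsf x)\mathsf y=\mathsf P(\mathsf x)$. On its fraction field let $\mathsf D_1$ be the unique derivation vanishing on $\Lambda$ with $\mathsf D_1\mathsf x=1$, and $\mathsf D_n=\mathsf D_1^n/n!$. For $i\ge 0$, $n\ge1$ there are unique $\mathsf s_{i,n},\mathsf t_{i,n}\in\Lambda[\mathsf x]$ with $\mathsf D_n(\mathsf x^i\mathsf y)=(\mathsf s_{i,n}+\mathsf t_{i,n}\mathsf y)/(2\mathsf y+\mathsf Q)^{2n-1}$. Put $\mu=\lfloor (N-2g-1)/2\rfloor$, $\nu=\lfloor N/2\rfloor+1$, and let $\Gamma_N(\mathsf x)$ be the determinant of the $(\mu+1)\times(\mu+1)$ matrix with entries $\mathsf s_{i,n}$, rows $0\le i\le\mu$, columns $\nu\le n\le\nu+\mu$. Then $\mathsf F^{\mu(\mu+1)/2}$ divides $\Gamma_N$ in $\Lambda[\mathsf x]$; set $\Delta_N(\mathsf x)=\Gamma_N(\mathsf x)/\mathsf F(\mathsf x)^{\mu(\mu+1)/2}$. Finally $\varDelta_N(x)$ is the image of $\Delta_N(\mathsf x)$ under the ring homomorphism $\Lambda[\mathsf x]\to k[x]$ sending $\mathsf x\mapsto x$ and each $p_i$, $q_i$ to the coefficient of $x^i$ in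 $P$, $Q$ respectively. *)

(* Defs.v *)
From HB Require Import structures.
From mathcomp Require Import all_boot all_order all_algebra.
From mathcomp Require Import generic_quotient ring_quotient qpoly.
From mathcomp.multinomials Require Import freeg mpoly.
From mathcomp Require Import boolp classical_sets fsbigop.

Set Implicit Arguments.
Unset Strict Implicit.
Unset Printing Implicit Defensive.

Import Order.TTheory GRing.Theory Num.Theory.
Local Open Scope classical_set_scope.
Local Open Scope quotient_scope.
Local Open Scope ring_scope.

(* y^2 + Q(x) y - P(x), as a polynomial in y over the field R(x) *)
Definition curve_poly (R : idomainType) (P Q : {poly R}) :
    {poly {fraction {poly R}}} :=
  'X^2 + (tofrac Q)%:P * 'X - (tofrac P)%:P.

(* Frac (R[x, y] / (y^2 + Q y - P)), constructed as R(x)[y] / (y^2 + Q y - P).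
   The library makes it a commutative ring with inverses; it is a field as soon
   as curve_poly P Q is irreducible, e.g. when P has odd degree 2g+1 and Q has
   degree at most g. *)
Notation funfield P Q := {poly %/ curve_poly P Q}.

Section FunctionField.
Context (R : idomainType) (P Q : {poly R}).

Definition ffpoly (a : {poly R}) : funfield P Q :=
  qpolyC (curve_poly P Q) (tofrac a).
Definition ffconst (c : R) : funfield P Q := ffpoly c%:P.
Definition ffx : funfield P Q := ffpoly 'X.
Definition ffy : funfield P Q := in_qpoly (curve_poly P Q) 'X.

End FunctionField.

Definition eval2 (k S : comNzRingType) (f : k -> S) (u v : S)
    (a : {poly {poly k}}) : S :=
  (map_poly (fun c : {poly k} => (map_poly f c).[u]) a).[v].

Section Curve.
Context (k : fieldType) (g : nat) (P Q : {poly k}).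

Local Notation K := (funfield P Q).

(* Jacobian criterion for y^2 + Q(x) y = P(x); k is algebraically closed in
   the applications. *)
Definition smooth_affine :=
  forall x0 y0 : k, y0 ^+ 2 + Q.[x0] * y0 = P.[x0] ->
    ~ (y0 *+ 2 + Q.[x0] = 0 /\ (Q^`()).[x0] * y0 = (P^`()).[x0]).

Definition affine_point :=
  {xy : k * k | xy.2 ^+ 2 + Q.[xy.1] * xy.2 == P.[xy.1]}.

(* The points of X(k); None is the point at infinity. *)
Definition point : choiceType := option affine_point.
Definition infty : point := None.

(* X is glued from two affine plane curves: the one with coordinates (x, y),
   and the one with coordinates (1/x, y/x^(g+1)), in which the point at
   infinity is the origin.  For a point xi, chart xi gives the coordinate
   functions on the curve containing it, and chart_val xi their values at xi. *)
Definition chart (xi : point) : K * K :=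
  if xi is Some _ then (ffx P Q, ffy P Q)
  else ((ffx P Q)^-1, ffy P Q / ffx P Q ^+ g.+1).
Definition chart_val (xi : point) : k * k :=
  if xi is Some a then val a else (0, 0).

Definition eval_chart (xi : point) (a : {poly {poly k}}) : K :=
  eval2 (ffconst P Q) (chart xi).1 (chart xi).2 a.
Definition eval_val (xi : point) (a : {poly {poly k}}) : k :=
  eval2 id (chart_val xi).1 (chart_val xi).2 a.

(* f lies in the local ring O_xi: it is a quotient a/b of polynomials in the
   local coordinates whose denominator does not vanish at xi. *)
Definition regular_at (xi : point) (f : K) :=
  exists a b : {poly {poly k}},
    eval_val xi b != 0 /\ f * eval_chart xi b = eval_chart xi a.

Definition local_unit (xi : point) (f : K) :=
  [/\ f \is a GRing.unit, regular_at xi f & regular_at xi f^-1].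

Definition max_ideal (xi : point) (f : K) :=
  regular_at xi f /\ ~ local_unit xi f.

Definition uniformizer (xi : point) (t : K) :=
  t \is a GRing.unit /\
  forall f, max_ideal xi f <-> exists2 h, regular_at xi h & f = t * h.

(* The order of f at xi is n.  On a smooth curve uniformizers exist, and the
   condition does not depend on the choice of t. *)
Definition has_order (xi : point) (f : K) (n : int) :=
  forall t, uniformizer xi t -> local_unit xi (f / t ^ n).

Definition degree_zero : {pred {freeg point}} := fun D => deg D == 0.
Lemma degree_zero_zmod_closed : zmod_closed degree_zero.
Proof.
split=> [|D E]; first by rewrite unfold_in raddf0.
by rewrite !unfold_in raddfB /= => /eqP -> /eqP ->.
Qed.
HB.instance Definition _ :=
  GRing.isZmodClosed.Build {freeg point} degree_zero degree_zero_zmod_closed.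

Record div0 := Div0 { div_of : {freeg point}; _ : div_of \in degree_zero }.
HB.instance Definition _ := [isSub for div_of].
HB.instance Definition _ := [Choice of div0 by <:].
HB.instance Definition _ := [SubChoice_isSubZmodule of div0 by <:].

(* The principal divisors, as a subgroup of div0. *)
Definition principal : {pred div0} := fun D =>
  `[< exists2 f : K, f \is a GRing.unit &
        forall xi, has_order xi f (coeff xi (div_of D)) >].

Lemma eval_chartM xi a b :
  eval_chart xi (a * b) = eval_chart xi a * eval_chart xi b.
Proof.
pose f := @qpolyC _ (curve_poly P Q) \o @tofrac _ \o polyC.
pose h u v := horner_eval v \o map_poly (horner_eval u \o map_poly f).
exact: (rmorphM (h (chart xi).1 (chart xi).2)).
Qed.

Lemma eval_valM xi a b : eval_val xi (a * b) = eval_val xi a * eval_val xi b.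
Proof.
pose h u v := horner_eval v \o map_poly (horner_eval u \o map_poly (@idfun k)).
exact: (rmorphM (h (chart_val xi).1 (chart_val xi).2)).
Qed.

Lemma eval_val1 xi : eval_val xi 1 = 1.
Proof.
pose h u v := horner_eval v \o map_poly (horner_eval u \o map_poly (@idfun k)).
exact: (rmorph1 (h (chart_val xi).1 (chart_val xi).2)).
Qed.

Lemma regular_at1 xi : regular_at xi 1.
Proof.
exists 1, 1; rewrite mul1r; split=> //.
by rewrite eval_val1 oner_neq0.
Qed.

Lemma regular_atM xi f f' :
  regular_at xi f -> regular_at xi f' -> regular_at xi (f * f').
Proof.
move=> [a [b [b0 fb]]] [a' [b' [b'0 fb']]]; exists (a * a'), (b * b').
by rewrite eval_valM mulf_neq0 // !eval_chartM mulrACA fb fb'.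
Qed.

Lemma principal_zmod_closed : zmod_closed principal.
Proof.
split=> [|D E]; rewrite !unfold_in.
  apply/asboolP; exists 1; first exact: unitr1.
  by move=> xi t _; rewrite coeff0 expr0z divr1; split; 
    rewrite ?invr1 ?unitr1 //; exact: regular_at1.
move=> /asboolP[f uf fD] /asboolP[h uh hE]; apply/asboolP.
exists (f / h); first by rewrite unitrM uf unitrV.
move=> xi t ut; have [u1 r1 r1'] := fD xi t ut; have [u2 r2 r2'] := hE xi t ut.
have tU := ut.1.
have -> : f / h / t ^ coeff xi (div_of (D - E)) =
    (f / t ^ coeff xi (div_of D)) / (h / t ^ coeff xi (div_of E)).
  have -> : div_of (D - E) = div_of D - div_of E by exact: (raddfB val).
  rewrite coeffB exprzDr // -[t ^ (- _)]invr_expz.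
  rewrite !invrM ?unitrV ?unitrXz // !invrK.
  by rewrite mulrACA [RHS]mulrACA (mulrC h^-1).
split; first by rewrite unitrM u1 unitrV.
  exact: regular_atM.
by rewrite invrM ?unitrV // invrK; exact: regular_atM.
Qed.
HB.instance Definition _ :=
  GRing.isZmodClosed.Build div0 principal principal_zmod_closed.

Definition jacobian := {ideal_quot principal}.

Lemma degree_zero_sub_infty (xi : point) : << xi >> - << infty >> \in degree_zero.
Proof. by rewrite unfold_in raddfB /= !degU. Qed.

Definition abel_jacobi (xi : point) : jacobian :=
  \pi_jacobian (Div0 (degree_zero_sub_infty xi)).

Definition torsion (N : nat) : set jacobian := [set a | a *+ N = 0].
Definition torsion_tilde (N : nat) : set jacobian := torsion N `\` torsion 2.

(* By the symmetry of the curve it is equivalent to ask for one or for all of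
   the points above x0; there always is one, k being algebraically closed. *)
Definition T_tilde (N : nat) : set k :=
  [set x0 | forall a : affine_point,
     (val a).1 = x0 -> torsion_tilde N (abel_jacobi (Some a))].

(* The product over the set T_tilde N, which is finite. *)
Definition U_tilde (N : nat) : {poly k} :=
  \big[*%R/1]_(x0 \in T_tilde N) ('X - x0%:P).

End Curve.

Section Generic.
Context (g : nat).

(* Z[p_0, .., p_2g, q_0, .., q_g]: the first 2g+1 variables are the p_i, the
   remaining g+1 are the q_i. *)
Definition Lam := {mpoly int[g.*2.+1 + g.+1]}.

Definition genP : {poly Lam} :=
  \sum_(i < g.*2.+1) ('X_(lshift g.+1 i))%:P * 'X^i + 'X^(g.*2.+1).
Definition genQ : {poly Lam} :=
  \sum_(i < g.+1) ('X_(rshift g.*2.+1 i))%:P * 'X^i.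
Definition genF : {poly Lam} := genP *+ 4 + genQ ^+ 2.

Local Notation L := (funfield genP genQ).
Local Notation x := (ffx genP genQ).
Local Notation y := (ffy genP genQ).

Definition is_D1 (D : L -> L) :=
  [/\ forall a b, D (a + b) = D a + D b,
      forall a b, D (a * b) = D a * b + a * D b,
      forall c, D (ffconst genP genQ c) = 0 &
      D x = 1].

(* D1, s_ and Delta_gen pick the unique solution of their defining property. *)
Definition D1 : L -> L := xget (fun=> 0) [set D | is_D1 D].

Definition Dn (n : nat) (f : L) : L := iter n D1 f / n`!%:R.

(* st is the pair (s_{i,n}, t_{i,n}) *)
Definition is_st (i n : nat) (st : {poly Lam} * {poly Lam}) :=
  Dn n (x ^+ i * y) =
    (ffpoly genP genQ st.1 + ffpoly genP genQ st.2 * y) /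
      (y *+ 2 + ffpoly genP genQ genQ) ^+ (n.*2.-1).
Definition s_ (i n : nat) : {poly Lam} := (xget (0, 0) [set st | is_st i n st]).1.

Definition mu (N : nat) : nat := (N - g.*2.+1)./2.
Definition nu (N : nat) : nat := N./2.+1.

Definition Gam (N : nat) : {poly Lam} :=
  \det (\matrix_(i < (mu N).+1, j < (mu N).+1) s_ i (nu N + j)).

Definition Delta_gen (N : nat) : {poly Lam} :=
  xget 0 [set D | D * genF ^+ (mu N * (mu N).+1)./2 = Gam N].

(* Lambda -> k, p_i |-> coefficient of x^i in P, q_i |-> that in Q *)
Definition specialize (k : fieldType) (P Q : {poly k}) : Lam -> k :=
  mmap intr (fun v => match split v with inl i => P`_i | inr i => Q`_i end).

Definition Delta (k : fieldType) (P Q : {poly k}) (N : nat) : {poly k} :=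
  map_poly (specialize P Q) (Delta_gen N).

End Generic.

Definition eps (r g : nat) : nat := (g - r.+1./2) * (r./2).+1.

(* Main.v *)
From HB Require Import structures.
From mathcomp.multinomials Require Import freeg mpoly.
From mathcomp Require Import boolp classical_sets fsbigop.
From mathcomp Require Import all_boot all_order all_algebra all_fingroup.
From mathcomp Require Import generic_quotient ring_quotient qpoly.
From mathcomp Require Import ring zify.
Require Import Defs.

Set Implicit Arguments.
Unset Strict Implicit.
Unset Printing Implicit Defensive.

Import GRing.Theory.
Local Open Scope ring_scope.

(** Let x0 be in T_tilde N, and let a = (x0, y0) be a point above it.

    Since N ([a] - [infty]) is principal, it is the divisor of a function f
    with no pole at finite distance and a pole of order N at infinity.  So
    f = A(x) + B(x) y with deg A <= N/2 and deg B <= (N - 2g - 1)/2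
    ([regular_affine_poly], [degree_bounds_infty]), and f vanishes to order N
    at a.  Since a is not 2-torsion, w = 2y + Q(x) does not vanish at a
    ([two_torsion_of_ramified]).  Hence t = x - x0 is a uniformizer at a, and
    B <> 0, because A(x) alone cannot vanish to order N.

    Write N' = N + r.  The determinant Gamma_N' has entries s_(i,n), the
    values of w^(2n-1) D_n(x^i y), for n in a range beyond the degree of any
    polynomial A that can occur.  For j <= r/2 the polynomial
    b_j = B (x - x0)^j has degree at most mu(N'), and b_j y agrees with
    f (x - x0)^j, of order at least N + j at a, up to a polynomial in x that
    D_n kills.  So D_n(b_j y) vanishes to order at least N + j - n at a
    ([hasse_num_vanish]).  A unitriangular change of basis (up to nonzero
    scalars) replaces r/2 + 1 rows of the matrix by these combinations; the
    columns of a term of the Leibniz formula being distinct, every term is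
    divisible by (x - x0)^eps ([dvdp_det_relations]).  As F(x0) = w(a)^2 is
    not 0, dividing by a power of F is harmless ([dvdp_Delta]).

    Two devices make this work in every characteristic.  The numerators of
    the D_n(x^i y) are given by a recursion with integral coefficients in P, Q,
    y and w ([taylor_num]), valid in every commutative ring; so they can be
    computed over Lambda, where D_n = D_1^n/n! makes sense, and then compared
    with Hasse derivatives over k.  And the completed local ring at a is
    replaced by k[t]/(t^e), into which the curve maps by x = x0 + t, y = h(t),
    where h is a root of the equation of the curve modulo a high power of t
    ([hensel_quadratic]). *)

(** * Taylor coefficients of a root of a quadratic equation *)

Lemma nderivnM (R : comNzRingType) (p q : {poly R}) n :
  (p * q)^`N(n) = \sum_(i < n.+1) p^`N(i) * q^`N(n - i).
Proof.
elim/poly_ind: p n => [|p c IHp] n.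
  rewrite mul0r raddf0 big1 // => i _; by rewrite raddf0 mul0r.
case: n => [|n]; first by rewrite big_ord1 !nderivn0.
rewrite mulrDl nderivnD mul_polyC nderivnZ mulrAC -[_ * q * 'X]addr0.
rewrite nderivnMXaddC !IHp [RHS]big_ord_recl.
have -> : \sum_(i < n.+2) p^`N(i) * q^`N(n.+1 - i) =
    p * q^`N(n.+1) + \sum_(i < n.+1) p^`N(i.+1) * q^`N(n - i).
  by rewrite big_ord_recl nderivn0 subn0.
have -> : \sum_(i < n.+1) (p * 'X + c%:P)^`N(lift ord0 i) * q^`N(n.+1 - lift ord0 i)
   = \sum_(i < n.+1) p^`N(i) * q^`N(n - i)
     + (\sum_(i < n.+1) p^`N(i.+1) * q^`N(n - i)) * 'X.
  rewrite mulr_suml -big_split; apply: eq_bigr => i _.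
  by rewrite lift0 nderivnMXaddC subSS mulrDl mulrAC.
by rewrite subn0 nderivn0 -mul_polyC; ring.
Qed.

Lemma convolution_ends (S : pzRingType) (a b : nat -> S) m :
  \sum_(i < m.+2) a i * b (m.+1 - i)%N =
  a 0%N * b m.+1 + a m.+1 * b 0%N + \sum_(i < m) a i.+1 * b (m - i)%N.
Proof.
rewrite big_ord_recl big_ord_recr subn0 /= /bump /= add1n subnn -addrA.
by congr (_ + _); rewrite addrC; congr (_ + _); apply: eq_bigr => i _; rewrite add1n subSS.
Qed.

Section TaylorNumerators.
Context (S : comNzRingType) (P Q : nat -> S) (y w : S).

(** One step of the recursion below; d lists the numerators already computed. *)
Definition taylor_step (m : nat) (d : seq S) : S :=
  w ^+ m.*2 * (P m.+1 - Q m.+1 * y)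
  - \sum_(i < m) d`_i * d`_(m.-1 - i)
  - \sum_(i < m) Q i.+1 * d`_(m.-1 - i) * w ^+ i.*2.+1.

Fixpoint taylor_nums (m : nat) : seq S :=
  if m is m'.+1 then rcons (taylor_nums m') (taylor_step m' (taylor_nums m')) else [::].

(** The numerator of the Taylor coefficient of index m + 1, rather than m, of a
    root v of v^2 + Q v = P with constant term y: the index 0 would need the
    denominator w^(-1).  Here w = 2 y + Q 0, and P, Q are given by their Taylor
    coefficients. *)
Definition taylor_num (m : nat) : S := (taylor_nums m.+1)`_m.

Lemma size_taylor_nums m : size (taylor_nums m) = m.
Proof. by elim: m => //= m IHm; rewrite size_rcons IHm. Qed.

Lemma nth_taylor_nums m i : (i < m)%N -> (taylor_nums m)`_i = taylor_num i.
Proof.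
elim: m => // m IHm; rewrite ltnS leq_eqVlt => /predU1P[->//|ltim].
by rewrite /= nth_rcons size_taylor_nums ltim IHm.
Qed.

Lemma taylor_numE m : taylor_num m = w ^+ m.*2 * (P m.+1 - Q m.+1 * y)
  - \sum_(i < m) taylor_num i * taylor_num (m.-1 - i)
  - \sum_(i < m) Q i.+1 * taylor_num (m.-1 - i) * w ^+ i.*2.+1.
Proof.
rewrite {1}/taylor_num /= nth_rcons size_taylor_nums ltnn eqxx /taylor_step.
congr (_ - _ - _); apply: eq_bigr => i _; rewrite !nth_taylor_nums //; case: i => i /=; lia.
Qed.

(** The numerator over w^(2n-1) of the n-th coefficient of a product b v, when
    b n = 0. *)
Definition taylor_num_mul (b : nat -> S) (n : nat) : S :=
  \sum_(j < n) b j * w ^+ j.*2 * taylor_num (n - j).-1.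

(** Compare coefficients of index m + 1 in v^2 + Q v = P: the terms that contain
    v_(m+1) add up to w v_(m+1).  Multiplying by w^(2m) turns the remaining
    products into products of numerators, so w is never inverted. *)
Lemma taylor_numP (v : nat -> S) (n0 : nat) :
    v 0 = y -> w = y *+ 2 + Q 0 ->
    (forall n, (n <= n0)%N ->
       \sum_(i < n.+1) v i * v (n - i)%N + \sum_(i < n.+1) Q i * v (n - i)%N = P n) ->
  forall m, (m < n0)%N -> w ^+ m.*2.+1 * v m.+1 = taylor_num m.
Proof.
move=> v0 wE vP m; elim/ltn_ind: m => m IHm ltm.
have E := vP _ ltm; rewrite !convolution_ends v0 in E.
have {}E : w * v m.+1 = P m.+1 - Q m.+1 * y
   - \sum_(i < m) v i.+1 * v (m - i)%N - \sum_(i < m) Q i.+1 * v (m - i)%N.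
  by rewrite -E wE; ring.
rewrite exprSr -mulrA E taylor_numE !mulrBr !mulr_sumr.
congr (_ - _ - _); apply: eq_bigr => -[i ltim] _ /=.
  have [<- <-] : w ^+ i.*2.+1 * v i.+1 = taylor_num i /\
      w ^+ (m.-1 - i).*2.+1 * v (m.-1 - i).+1 = taylor_num (m.-1 - i).
    by split; apply: IHm; lia.
  have -> : (m - i)%N = (m.-1 - i).+1 by lia.
  have -> : m.*2 = (i.*2.+1 + (m.-1 - i).*2.+1)%N by lia.
  by rewrite exprD; ring.
have <- : w ^+ (m.-1 - i).*2.+1 * v (m.-1 - i).+1 = taylor_num (m.-1 - i).
  by apply: IHm; lia.
have -> : (m - i)%N = (m.-1 - i).+1 by lia.
have -> : m.*2 = (i.*2.+1 + (m.-1 - i).*2.+1)%N by lia.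
by rewrite exprD; ring.
Qed.

Lemma taylor_num_mulP (v b : nat -> S) (n : nat) :
    v 0 = y -> w = y *+ 2 + Q 0 -> b n = 0 ->
    (forall m, (m <= n)%N ->
       \sum_(i < m.+1) v i * v (m - i)%N + \sum_(i < m.+1) Q i * v (m - i)%N = P m) ->
  w ^+ n.*2.-1 * (\sum_(j < n.+1) b j * v (n - j)%N) = taylor_num_mul b n.
Proof.
move=> v0 wE bn vP; rewrite big_ord_recr /= bn mul0r addr0 mulr_sumr.
apply: eq_bigr => -[j ltjn] _ /=.
have := @taylor_numP v n v0 wE vP (n - j).-1; rewrite prednK ?subn_gt0 // => <-; last lia.
have -> : n.*2.-1 = (j.*2 + (n - j).-1.*2.+1)%N by lia.
by rewrite exprD; ring.
Qed.

End TaylorNumerators.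

Lemma rmorph_taylor_num (S S' : comNzRingType) (f : {rmorphism S -> S'}) P Q y w m :
  f (taylor_num P Q y w m) = taylor_num (f \o P) (f \o Q) (f y) (f w) m.
Proof.
elim/ltn_ind: m => m IHm; rewrite !taylor_numE !rmorphB !rmorphM !rmorphB !rmorphM !rmorphXn.
congr (_ - _ - _); rewrite rmorph_sum; apply: eq_bigr => -[i lti] _ /=.
  by rewrite rmorphM !IHm //; lia.
by rewrite !rmorphM rmorphXn IHm //; lia.
Qed.

Lemma rmorph_taylor_num_mul (S S' : comNzRingType) (f : {rmorphism S -> S'}) P Q y w b n :
  f (taylor_num_mul P Q y w b n) =
  taylor_num_mul (f \o P) (f \o Q) (f y) (f w) (f \o b) n.
Proof.
rewrite rmorph_sum; apply: eq_bigr => i _.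
by rewrite !rmorphM rmorphXn rmorph_taylor_num.
Qed.

Lemma eq_taylor_num (S : comNzRingType) (P P' Q Q' : nat -> S) y w m :
  P =1 P' -> Q =1 Q' -> taylor_num P Q y w m = taylor_num P' Q' y w m.
Proof.
move=> eqP eqQ; elim/ltn_ind: m => m IHm; rewrite !taylor_numE eqP eqQ.
congr (_ - _ - _); apply: eq_bigr => -[i lti] _ /=; rewrite ?eqQ !IHm //; lia.
Qed.

Lemma eq_taylor_num_mul (S : comNzRingType) (P P' Q Q' b b' : nat -> S) y w n :
  P =1 P' -> Q =1 Q' -> b =1 b' -> taylor_num_mul P Q y w b n = taylor_num_mul P' Q' y w b' n.
Proof.
move=> eqP eqQ eqb; apply: eq_bigr => i _.
by rewrite eqb (eq_taylor_num _ _ _ eqP eqQ).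
Qed.

(** Hensel lifting: the derivative of the equation at the simple root y0 is
    invertible, which determines the next coefficient. *)
Lemma hensel_quadratic (k : fieldType) (P Q : {poly k}) (y0 : k) :
    y0 ^+ 2 + Q.[0] * y0 = P.[0] -> y0 *+ 2 + Q.[0] != 0 ->
  forall M, exists2 h : {poly k}, h.[0] = y0 & 'X^M %| h ^+ 2 + Q * h - P.
Proof.
move=> E0 w0; elim=> [|M [h h0 /dvdpP[e eE]]].
  by exists y0%:P; rewrite ?hornerC // expr0 dvd1p.
have [->|M0] := posnP M.
  exists y0%:P; rewrite ?hornerC // expr1 -['X]subr0 dvdp_XsubCl.
  by rewrite /root !hornerE E0 subrr.
pose c := - e.[0] / (y0 *+ 2 + Q.[0]).
exists (h + c *: 'X^M).
  by rewrite !hornerE h0 expr0n eqn0Ngt M0 mulr0 addr0.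
have -> : (h + c *: 'X^M) ^+ 2 + Q * (h + c *: 'X^M) - P =
   'X^M * (e + c%:P * (h *+ 2 + Q) + c%:P ^+ 2 * 'X^M).
  have -> : P = h ^+ 2 + Q * h - e * 'X^M by rewrite -eE; ring.
  by rewrite -mul_polyC; ring.
rewrite exprSr dvdp_mul // -[X in X %| _]subr0 dvdp_XsubCl /root.
rewrite !hornerE h0 expr0n eqn0Ngt M0 mulr0 addr0 /c mulfVK ?addrN //.
Qed.

Lemma dvdp_sum (k : fieldType) I (r : seq I) (p : pred I) (d : {poly k}) F :
  (forall i, p i -> d %| F i) -> d %| \sum_(i <- r | p i) F i.
Proof.
move=> dF; apply: (big_ind (fun q => d %| q)); [exact: dvdp0| |exact: dF].
by move=> q q'; apply: dvdp_add.
Qed.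

Lemma dvdXn_nderivn (k : fieldType) (p : {poly k}) M n :
  'X^M %| p -> 'X^(M - n) %| p^`N(n).
Proof.
move=> /dvdpP[q ->]; rewrite nderivnM; apply: dvdp_sum => -[i lei] _ /=.
apply: dvdp_mull; rewrite nderivnXn -mulr_natr dvdp_mulr //.
by rewrite dvdp_exp2l //; lia.
Qed.

(** * Determinants with entries of prescribed vanishing order *)

(** Remove the largest element: among n distinct naturals it is at least n - 1. *)
Lemma leq_sum_uniq (s : seq nat) :
  uniq s -> (\sum_(i < size s) i <= \sum_(x <- s) x)%N.
Proof.
have [m] : exists m, {in s, forall x, x < m}%N.
  exists (\max_(x <- s) x).+1 => x xs; rewrite ltnS; exact: leq_bigmax_seq.
elim: m s => [|m IHm] s ltm us.
  case: s ltm {us} => [|x s] lt0; first by rewrite big_ord0.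
  by have := lt0 x (mem_head _ _).
have [ms|Nms] := boolP (m \in s); last first.
  apply: IHm => // x xs; have := ltm x xs; rewrite ltnS leq_eqVlt => /predU1P[xm|//].
  by rewrite -xm xs in Nms.
have := perm_to_rem ms => ps; rewrite (perm_big _ ps) (perm_size ps) big_cons /=.
have ur := rem_uniq m us.
have ltr : {in rem m s, forall x, x < m}%N.
  move=> x; rewrite mem_rem_uniq // inE => /andP[/= xm /ltm].
  by rewrite ltnS ltn_neqAle xm.
rewrite big_ord_recr /= addnC leq_add ?IHm //.
have /(uniq_leq_size ur) : {subset rem m s <= iota 0 m}.
  by move=> x /ltr; rewrite mem_iota.
by rewrite size_iota.
Qed.

Lemma leq_sum_inj n (c : 'I_n -> nat) :
  injective c -> (\sum_(i < n) i <= \sum_(i < n) c i)%N.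
Proof.
move=> cI; have := @leq_sum_uniq [seq c i | i <- enum 'I_n].
rewrite size_map size_enum_ord map_inj_uniq // enum_uniq big_map big_enum.
exact.
Qed.

(** Truncation only increases the terms, and the sum of the c j, being distinct, is
    at least that of the j.  So the sum is at least
    (r/2 + 1) (g - r + r/2) = (r/2 + 1) (g - (r + 1)/2), with halves rounded down. *)
Lemma eps_le r g (c : 'I_(r./2).+1 -> nat) :
  injective c -> (eps r g <= \sum_(j < (r./2).+1) (g + j + c j - r))%N.
Proof.
move=> /leq_sum_inj cI; rewrite /eps; set R := r./2 in c cI *.
have : r = ((r.+1)./2 + R)%N by rewrite /R; lia.
move: (r.+1)./2 => h rE.
have [leg|ltg] := leqP h g; last by rewrite (eqP (_ : g - h == 0)%N) // subn_eq0 ltnW.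
rewrite -(leq_add2r (\sum_(j < R.+1) r)) -big_split /=.
have : (\sum_(j < R.+1) (g + j + c j) <= \sum_(i < R.+1) (g + i + c i - r + r))%N.
  by apply: leq_sum => i _; lia.
apply: leq_trans; rewrite !big_split /= !sum_nat_const card_ord.
have := leq_add (leqnn (\sum_(i < R.+1) i)) cI.
have -> : (\sum_(i < R.+1) i + \sum_(i < R.+1) i = R.+1 * R)%N.
  elim: (R) => [|n IHn]; first by rewrite big_ord1.
  by rewrite big_ord_recr /= addnACA IHn; lia.
move: (\sum_(i < R.+1) i)%N (\sum_(i < R.+1) c i)%N => s1 s2; rewrite rE => *.
by clear cI rE; clearbody R; rewrite mulnBl; have := leq_mul2r R.+1 h g; nia.
Qed.

Lemma dvdp_det_sum (k : fieldType) n (A : 'M[{poly k}]_n) (q : {poly k})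
    (e : 'I_n -> 'I_n -> nat) (E : nat) :
    (forall i j, q ^+ e i j %| A i j) ->
    (forall s : 'S_n, (E <= \sum_i e i (s i))%N) ->
  q ^+ E %| \det A.
Proof.
move=> dA leE; apply: dvdp_sum => s _; apply: dvdp_mull.
apply: dvdp_trans (dvdp_exp2l _ (leE s)) _.
rewrite (big_morph _ (exprD q) (expr0 q)).
by apply: (big_ind2 (fun x y => x %| y)) => // x y z t; apply: dvdp_mul.
Qed.

(** The polynomials b i, of distinct consecutive degrees, form a basis: passing
    from the monomials to them is triangular, with the leading coefficients on the
    diagonal. *)
Lemma dvdp_det_basis (k : fieldType) m (G : 'M[{poly k}]_m)
    (b : 'I_m -> {poly k}) (D : {poly k}) :
    (forall i, size (b i) = i.+1) ->
  D %| \det (\matrix_(i, j) \sum_(l < m) (b i)`_l *: G l j) -> D %| \det G.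
Proof.
move=> sb.
pose U : 'M[{poly k}]_m := \matrix_(i, l) ((b i)`_l)%:P.
have -> : \matrix_(i, j) \sum_(l < m) (b i)`_l *: G l j = U *m G.
  by apply/matrixP => i j; rewrite !mxE; apply: eq_bigr => l _; rewrite mxE mul_polyC.
rewrite det_mulmx det_trig.
  have -> : \prod_i U i i = (\prod_i lead_coef (b i))%:P.
    by rewrite rmorph_prod; apply: eq_bigr => i _; rewrite mxE lead_coefE sb.
  rewrite mul_polyC dvdpZr //; apply/prodf_neq0 => i _.
  by rewrite lead_coef_eq0 -size_poly_eq0 sb.
by apply/is_trig_mxP => i j ltij; rewrite mxE nth_default ?sb.
Qed.

(** Rows are indexed by monomials and G is read as a linear map on polynomials of
    degree < m.  If it sends each B q^j to a multiple of a high power of q, replace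
    the monomials of degrees deg B, ..., deg B + r/2 by the B q^j and expand the
    determinant. *)
Lemma dvdp_det_relations (k : fieldType) m (G : 'M[{poly k}]_m)
    (B q : {poly k}) (r g : nat) :
    B != 0 -> size q = 2 -> (size B + r./2 <= m)%N ->
    (forall (j : 'I_(r./2).+1) (c : 'I_m),
      q ^+ (g + j + (m.-1 - c) - r) %| \sum_(l < m) (B * q ^+ j)`_l *: G l c) ->
  q ^+ eps r g %| \det G.
Proof.
move=> B0 sq leBm dvG; set R := r./2 in leBm dvG *.
set d := (size B).-1; have sB : size B = d.+1 by rewrite prednK // lt0n size_poly_eq0.
pose inr (i : nat) := (d <= i <= d + R)%N.
pose b (i : 'I_m) := if inr i then B * q ^+ (i - d) else 'X^i.
pose e (i j : 'I_m) := if inr i then (g + (i - d) + (m.-1 - j) - r)%N else 0%N.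
have sqn n : size (q ^+ n) = n.+1.
  by rewrite -[size _]prednK ?lt0n ?size_poly_eq0 ?expf_neq0 -?size_poly_eq0 ?sq //
             size_exp sq mul1n.
(* Monomials outside the degree range [deg B, deg B + r/2] are kept. *)
apply: (@dvdp_det_basis _ _ _ b) => [i|].
  rewrite /b; case: ifP => [/andP[ledi _]|_]; last by rewrite size_polyXn.
  by rewrite size_mul -?size_poly_eq0 ?sqn ?sB //; lia.
apply: (@dvdp_det_sum _ _ _ _ e) => [i j|s].
  rewrite mxE /b /e; case: ifP => [/andP[ledi leid]|_]; last by rewrite expr0 dvd1p.
  have lti : (i - d < R.+1)%N by lia.
  exact: (dvG (Ordinal lti)).
have ltf (j : 'I_R.+1) : (d + j < m)%N by case: j => j /= ltj; lia.
pose f j := Ordinal (ltf j).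
have fI : injective f by move=> i j /(congr1 val) /= /addnI /val_inj.
(* c j counts the columns to the right of the one that s assigns to B q^j. *)
pose c j := (m.-1 - s (f j))%N.
have cI : injective c.
  move=> i j; rewrite /c => cij; apply/fI/(@perm_inj _ s)/val_inj => /=.
  by have := ltn_ord (s (f i)); have := ltn_ord (s (f j)); lia.
apply: leq_trans (eps_le g cI) _.
rewrite (eq_bigr (fun j => e (f j) (s (f j)))); last first.
  by move=> j _; rewrite /e /inr /= leq_addr leq_add2l -ltnS ltn_ord /= addKn.
rewrite -(big_imset (fun i => e i (s i)) (A := predT)) /=; last by move=> ? ? _ _ /fI.
by rewrite [leqRHS](bigID (mem (f @: predT))) /= leq_addr.
Qed.

Lemma dvdp_prod_XsubC_exp (k : fieldType) (s : seq k) (D : {poly k}) e :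
    uniq s -> {in s, forall x0, ('X - x0%:P) ^+ e %| D} ->
  (\prod_(x0 <- s) ('X - x0%:P)) ^+ e %| D.
Proof.
elim: s => [|x s IHs] /=; first by rewrite big_nil expr1n dvd1p.
case/andP=> xs us dD; rewrite big_cons exprMn Gauss_dvdp.
  rewrite dD ?mem_head // IHs // => y ys; apply: dD; by rewrite inE ys orbT.
rewrite coprimep_expl // coprimep_expr // coprimep_sym coprimep_XsubC.
by rewrite root_prod_XsubC.
Qed.

(** * Numerators of the Hasse derivatives of b(x) y *)

(** The outer variable is y and the inner one is x. *)
Definition plane_curve (R : comNzRingType) (P Q : {poly R}) : {poly {poly R}} :=
  'X^2 + Q%:P * 'X - P%:P.

(** The numerator over w^(2n-1) of the n-th Hasse derivative of b(x) y, as a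
    polynomial in x and y; the Taylor coefficients of P, Q and b at x are their
    Hasse derivatives. *)
Definition hasse_num (R : comNzRingType) (P Q b : {poly R}) (n : nat) :
    {poly {poly R}} :=
  taylor_num_mul (fun i => (P^`N(i))%:P) (fun i => (Q^`N(i))%:P) 'X ('X *+ 2 + Q%:P)
    (fun j => (b^`N(j))%:P) n.

Lemma map_hasse_num (R R' : comNzRingType) (f : {rmorphism R -> R'}) P Q b n :
  map_poly (map_poly f) (hasse_num P Q b n) =
  hasse_num (map_poly f P) (map_poly f Q) (map_poly f b) n.
Proof.
rewrite /hasse_num rmorph_taylor_num_mul rmorphD rmorphMn /= map_polyX map_polyC /=.
by apply: eq_taylor_num_mul => i /=; rewrite map_polyC /= nderivn_map.
Qed.

Lemma rmorph_hasse_num (R S : comNzRingType) (f : {rmorphism {poly {poly R}} -> S}) P Q b n :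
  f (hasse_num P Q b n) =
  taylor_num_mul (fun i => f (P^`N(i))%:P) (fun i => f (Q^`N(i))%:P) (f 'X)
    (f 'X *+ 2 + f Q%:P) (fun j => f (b^`N(j))%:P) n.
Proof. by rewrite rmorph_taylor_num_mul rmorphD rmorphMn. Qed.

Lemma map_plane_curve (R R' : comNzRingType) (f : {rmorphism R -> R'}) P Q :
  map_poly (map_poly f) (plane_curve P Q) = plane_curve (map_poly f P) (map_poly f Q).
Proof.
by rewrite /plane_curve expr2 rmorphB rmorphD !rmorphM /= !map_polyC map_polyX -expr2.
Qed.

Lemma hasse_num_sum (R : comNzRingType) (P Q b : {poly R}) m n : (size b <= m)%N ->
  hasse_num P Q b n = \sum_(i < m) (b`_i)%:P *: hasse_num P Q 'X^i n.
Proof.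
move=> sb; rewrite /hasse_num /taylor_num_mul.
under [RHS]eq_bigr => i _ do rewrite scaler_sumr.
rewrite exchange_big; apply: eq_bigr => j _ /=.
under eq_bigr => i _ do rewrite !scalerAl.
rewrite -mulr_suml -mulr_suml; congr (_ * _ * _).
have {1}-> : b = \sum_(i < m) b`_i *: 'X^i.
  rewrite -poly_def; apply/polyP => i; rewrite coef_poly.
  by case: ltnP => // /(leq_trans sb) /leq_sizeP->.
rewrite !raddf_sum /=; apply: eq_bigr => i _.
by rewrite nderivnZ -mul_polyC rmorphM /= mul_polyC.
Qed.

Lemma nderivn_comp_shift (R : comNzRingType) (p : {poly R}) c n :
  (p \Po ('X + c%:P))^`N(n) = p^`N(n) \Po ('X + c%:P).
Proof.
elim/poly_ind: p n => [|p a IHp] n; first by rewrite comp_poly0 raddf0 comp_poly0.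
case: n => [|n]; first by rewrite !nderivn0.
rewrite nderivnMXaddC !(comp_polyD, comp_polyM, comp_polyX, comp_polyC).
rewrite mulrDr -addrA [_ * c%:P]mulrC mul_polyC nderivnD -!IHp.
rewrite -[_ * 'X]addr0 nderivnMXaddC nderivnD nderivnZ nderivnC.
by rewrite -mul_polyC /=; ring.
Qed.

Section Specialization.
Context (k : fieldType) (P Q : {poly k}) (x0 : k).
Local Notation sh p := (p \Po ('X + x0%:P)).

(** Map the curve to k[t]/(t^(M-n)) by x = x0 + t, y = h(t), and let v be the
    sequence of Hasse derivatives of h.  They satisfy the equations defining the
    numerators, because Hasse derivatives of order at most n preserve divisibility
    by t^M up to t^n.  So s(x0 + t) is w^(2n-1) times the n-th Hasse derivative of
    b h, which is that of A + b h since deg A < n, hence 0. *)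
Lemma hasse_num_vanish (A b s h : {poly k}) (q : {poly {poly k}}) (M n : nat) :
    'X^M %| h ^+ 2 + sh Q * h - sh P ->
    'X^M %| sh A + sh b * h ->
    (size A <= n)%N -> (size b <= n)%N ->
    hasse_num P Q b n = s%:P + q * plane_curve P Q ->
  ('X - x0%:P) ^+ (M - n) %| s.
Proof.
move=> hh hAb sA sb hs; have [->|e_gt0] := posnP (M - n)%N; first by rewrite expr0 dvd1p.
set e := (M - n)%N in e_gt0 *.
pose pi : {rmorphism {poly k} -> {poly %/ 'X^e : {poly k}}} := in_qpoly 'X^e.
have pi0 p : 'X^e %| p -> pi p = 0.
  move=> dp; apply/eqP; rewrite -val_eqE /= mk_monic_Xn prednK //.
  by rewrite -Pdiv.IdomainMonic.modpE ?monicXn // -/(_ %| _).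
have pi0P p : pi p = 0 -> 'X^e %| p.
  move/eqP; rewrite -val_eqE /= mk_monic_Xn prednK //.
  by rewrite -Pdiv.IdomainMonic.modpE ?monicXn // -/(_ %| _).
pose phi : {rmorphism {poly {poly k}} -> {poly k}} :=
  horner_eval h \o map_poly (comp_poly ('X + x0%:P)).
have phiC p : phi p%:P = sh p.
  by rewrite /phi /= map_polyC /= /horner_eval hornerC.
have phiX : phi 'X = h by rewrite /phi /= map_polyX /horner_eval hornerX.
(* phi and pi are only used through the equations above. *)
clearbody phi pi.
suff : pi (sh s) = 0.
  move/pi0P/dvdpP => [u uE]; apply/dvdpP; exists (u \Po ('X - x0%:P)).
  have -> : s = sh s \Po ('X - x0%:P).
    by rewrite -comp_polyA comp_polyD comp_polyX comp_polyC subrK comp_polyXr.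
  by rewrite uE comp_polyM (rmorphXn (comp_poly _)) /= comp_polyX.
have := congr1 (pi \o phi) hs.
rewrite /= rmorphD rmorphM phiC; have -> : phi (plane_curve P Q) = h ^+ 2 + sh Q * h - sh P.
  by rewrite /plane_curve expr2 rmorphB rmorphD !rmorphM phiX !phiC -expr2.
rewrite rmorphD rmorphM [pi (_ - _)]pi0 ?mulr0 ?addr0; last first.
  by apply: dvdp_trans hh; rewrite dvdp_exp2l ?leq_subr.
move=> <-; rewrite !rmorph_taylor_num_mul.
pose v i := pi h^`N(i).
rewrite (@eq_taylor_num_mul _ _ (fun i => pi (sh P)^`N(i)) _ (fun i => pi (sh Q)^`N(i))
   _ (fun i => pi (sh b)^`N(i))); first last.
- by move=> i /=; rewrite phiC nderivn_comp_shift.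
- by move=> i /=; rewrite phiC nderivn_comp_shift.
- by move=> i /=; rewrite phiC nderivn_comp_shift.
rewrite -(@taylor_num_mulP _ _ _ _ _ v).
- have -> : \sum_(j < n.+1) pi (sh b)^`N(j) * v (n - j)%N = pi (sh b * h)^`N(n).
    by rewrite nderivnM rmorph_sum; apply: eq_bigr => i _; rewrite rmorphM.
  have -> : (sh b * h)^`N(n) = (sh A + sh b * h)^`N(n).
    by rewrite nderivnD nderivn_comp_shift (nderivn_poly0 sA) comp_poly0 add0r.
  by rewrite pi0 ?mulr0 // dvdXn_nderivn.
- by rewrite /v nderivn0 phiX.
- by rewrite rmorphD rmorphMn phiX phiC nderivn0 rmorphD rmorphMn.
- by rewrite nderivn_comp_shift (nderivn_poly0 sb) comp_poly0 raddf0.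
move=> m lem; apply/eqP; rewrite -subr_eq0.
have <- : pi (h ^+ 2 + sh Q * h - sh P)^`N(m) =
   \sum_(i < m.+1) v i * v (m - i)%N + \sum_(i < m.+1) pi (sh Q)^`N(i) * v (m - i)%N
    - pi (sh P)^`N(m).
  rewrite nderivnB nderivnD expr2 !nderivnM rmorphB rmorphD !rmorph_sum.
  by congr (_ + _ - _); apply: eq_bigr => i _; rewrite rmorphM.
apply/eqP/pi0; apply: dvdp_trans (dvdXn_nderivn m hh).
by rewrite dvdp_exp2l // leq_sub2l.
Qed.
End Specialization.

(** * The function field as a quadratic extension of R(x) *)

Lemma size_quadratic (R : nzRingType) (a b : R) :
  size ('X^2 + a%:P * 'X - b%:P) = 3.
Proof.
rewrite -addrA size_polyDl ?size_polyXn // -polyCN size_MXaddC.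
by case: ifP => // _; rewrite size_polyC; case: (a != 0).
Qed.

Lemma monic_quadratic (R : nzRingType) (a b : R) :
  'X^2 + a%:P * 'X - b%:P \is monic.
Proof.
rewrite monicE lead_coefE size_quadratic /= coefB coefD coefXn eqxx coefMX coefC.
by rewrite coefC subr0 addr0.
Qed.

Lemma frac_num_den (R : idomainType) (u : {fraction R}) :
  exists n d, d != 0 /\ FracField.tofrac d * u = FracField.tofrac n.
Proof.
elim/quotW: u => x; exists x.1, x.2; split; first exact: denom_ratioP.
unlock FracField.tofrac; rewrite -[LHS]FracField.pi_mul; apply/eqmodP.
by rewrite /= FracField.equivfE /FracField.mulf !numden_Ratio ?mul1r ?mulr1
  ?denom_ratioP ?oner_neq0 // mulrC.
Qed.

Lemma linear_poly_eq0 (R : nzRingType) (a b : R) :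
  b%:P * 'X + a%:P = 0 -> a = 0 /\ b = 0.
Proof.
move/polyP => E; have := E 0%N; have := E 1%N.
by rewrite !coefD !coefMX !coefC /= add0r addr0 => -> ->.
Qed.

Lemma linear_polyE (R : nzRingType) (p : {poly R}) :
  (size p <= 2)%N -> p = (p`_0)%:P + (p`_1)%:P * 'X.
Proof.
move=> sp; apply/polyP => -[|[|i]]; rewrite coefD coefC coefMX coefC ?addr0 ?add0r //=.
by rewrite nth_default // (leq_trans sp).
Qed.

Section FunctionFieldTheory.
Context (R : idomainType) (P Q : {poly R}).
Local Notation K := (funfield P Q).
Local Notation y := (ffy P Q).

Lemma mk_monic_curve : mk_monic (curve_poly P Q) = curve_poly P Q.
Proof. by rewrite /mk_monic size_quadratic monic_quadratic. Qed.

Lemma size_mk_curve : size (mk_monic (curve_poly P Q)) = 3.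
Proof. by rewrite mk_monic_curve size_quadratic. Qed.

HB.instance Definition _ := GRing.RMorphism.copy (@ffpoly R P Q)
  (qpolyC (curve_poly P Q) \o @FracField.tofrac {poly R}).
HB.instance Definition _ := GRing.RMorphism.copy (@ffconst R P Q)
  (ffpoly P Q \o polyC).

Lemma qpolyC_in_qpoly c : qpolyC (curve_poly P Q) c = in_qpoly (curve_poly P Q) c%:P.
Proof.
apply: val_inj; rewrite /= mk_monic_curve Pdiv.CommonRing.rmodp_small //.
by rewrite size_quadratic (leq_ltn_trans (size_polyC_leq1 _)).
Qed.

Lemma ffy_curve : y ^+ 2 + ffpoly P Q Q * y = ffpoly P Q P.
Proof.
rewrite /ffy /ffpoly !qpolyC_in_qpoly -rmorphXn -rmorphM -rmorphD.
apply/eqP; rewrite -subr_eq0 -rmorphB; apply/eqP/val_inj.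
by rewrite /= mk_monic_curve Pdiv.RingMonic.rmodpp ?monic_quadratic.
Qed.

Lemma qpolyC_indep (a b : {fraction {poly R}}) :
  qpolyC (curve_poly P Q) a + qpolyC _ b * y = 0 -> a = 0 /\ b = 0.
Proof.
rewrite /ffy !qpolyC_in_qpoly -rmorphM -rmorphD => /(congr1 val) /=.
rewrite addrC mk_monic_curve Pdiv.CommonRing.rmodp_small; first exact: linear_poly_eq0.
rewrite size_quadratic size_MXaddC; case: ifP => // _.
by rewrite ltnS size_polyC; case: (b != 0).
Qed.

Lemma ffpoly_indep a b : ffpoly P Q a + ffpoly P Q b * y = 0 -> a = 0 /\ b = 0.
Proof.
by case/qpolyC_indep => a0 b0; split; apply/eqP; rewrite -tofrac_eq0 ?a0 ?b0.
Qed.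

Lemma ffpoly_unit a : a != 0 -> ffpoly P Q a \is a GRing.unit.
Proof.
move=> a0; apply/unitrP; exists (qpolyC _ (FracField.tofrac a)^-1).
have ta0 : FracField.tofrac a != 0 by rewrite tofrac_eq0.
by rewrite /ffpoly -!rmorphM mulVf // mulfV // rmorph1.
Qed.

(** Clear the denominators of the two coordinates in the basis 1, y. *)
Lemma funfield_decomp (f : K) :
  exists d a b, d != 0 /\ ffpoly P Q d * f = ffpoly P Q a + ffpoly P Q b * y.
Proof.
have [u [v fE]] : exists u v, f = qpolyC _ u + qpolyC _ v * y.
  exists (val f)`_0, (val f)`_1; rewrite /ffy !qpolyC_in_qpoly -rmorphM -rmorphD /=.
  have sf : (size (val f) <= 2)%N by have := size_mk_monic f; rewrite [X in (_ < X)%N]size_mk_curve.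
  apply: val_inj => /=; rewrite -[X in Pdiv.CommonRing.rmodp X](linear_polyE sf).
  by rewrite Pdiv.CommonRing.rmodp_small // size_mk_monic.
have [nu [du [du0 uE]]] : exists n d, d != 0 /\ FracField.tofrac d * u = FracField.tofrac n.
  exact: frac_num_den.
have [nv [dv [dv0 vE]]] : exists n d, d != 0 /\ FracField.tofrac d * v = FracField.tofrac n.
  exact: frac_num_den.
exists (du * dv), (dv * nu), (du * nv); split; first by rewrite mulf_neq0.
have UE : ffpoly P Q du * qpolyC _ u = ffpoly P Q nu by rewrite /ffpoly -uE rmorphM.
have VE : ffpoly P Q dv * qpolyC _ v = ffpoly P Q nv by rewrite /ffpoly -vE rmorphM.
by rewrite fE !(rmorphM (ffpoly P Q)) /= -UE -VE; ring.
Qed.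

Lemma ffpolyM a b : ffpoly P Q (a * b) = ffpoly P Q a * ffpoly P Q b.
Proof. exact: (rmorphM (ffpoly P Q)). Qed.

Definition ffeval (a : {poly {poly R}}) : K := (map_poly (ffpoly P Q) a).[y].
HB.instance Definition _ := GRing.RMorphism.copy ffeval
  (horner_eval y \o map_poly (ffpoly P Q)).

Lemma ffevalC a : ffeval a%:P = ffpoly P Q a.
Proof. by rewrite /ffeval map_polyC hornerC. Qed.
Lemma ffevalX : ffeval 'X = y.
Proof. by rewrite /ffeval map_polyX hornerX. Qed.

Lemma ffeval_curve : ffeval (plane_curve P Q) = 0.
Proof.
rewrite /plane_curve expr2 rmorphB rmorphD !rmorphM /= !ffevalC ffevalX -expr2.
by rewrite ffy_curve subrr.
Qed.

(** Division by the equation, monic of degree 2 in y. *)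
Lemma plane_curve_div (a : {poly {poly R}}) :
  exists q s t, a = q * plane_curve P Q + (s%:P + t%:P * 'X).
Proof.
have cm : plane_curve P Q \is monic by exact: monic_quadratic.
pose r := Pdiv.CommonRing.rmodp a (plane_curve P Q).
exists (Pdiv.CommonRing.rdivp a (plane_curve P Q)), r`_0, r`_1.
rewrite {1}(Pdiv.RingMonic.rdivp_eq cm a); congr (_ + _).
have sr : (size r <= 2)%N.
  have := Pdiv.CommonRing.ltn_rmodpN0 a (monic_neq0 cm).
  by rewrite [size (plane_curve _ _)]size_quadratic.
exact: linear_polyE.
Qed.

Lemma ffevalM a b : ffeval (a * b) = ffeval a * ffeval b.
Proof. exact: (rmorphM ffeval). Qed.
Lemma ffevalD a b : ffeval (a + b) = ffeval a + ffeval b.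
Proof. exact: (rmorphD ffeval). Qed.
Lemma ffevalB a b : ffeval (a - b) = ffeval a - ffeval b.
Proof. exact: (rmorphB ffeval). Qed.

Lemma ffeval_linear_relation A B D a b :
  ffeval ((A%:P + B%:P * 'X) * b - D%:P * a) =
  (ffpoly P Q A + ffpoly P Q B * y) * ffeval b - ffpoly P Q D * ffeval a.
Proof. by rewrite ffevalB !ffevalM ffevalD ffevalM !ffevalC ffevalX. Qed.

(** The kernel of R[x, y] -> K is generated by the equation of the curve, since the
    remainder of a division by it has degree at most 1 in y. *)
Lemma ffeval_eq0 (a : {poly {poly R}}) :
  ffeval a = 0 -> exists q, a = q * plane_curve P Q.
Proof.
have [q [s [t ->]]] := plane_curve_div a; rewrite rmorphD rmorphM /= ffeval_curve mulr0 add0r.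
rewrite rmorphD rmorphM /= ffevalX !ffevalC => /ffpoly_indep[-> ->].
by exists q; rewrite mul0r !addr0.
Qed.

End FunctionFieldTheory.

(** * Derivations of the function field *)

(** The inductive step of [iter_derivation_ffpoly_w]: with w^2 = F, differentiate
    H u = G w and multiply by 2 H F, so that D w appears only in 2 w (D w) = F'. *)
Lemma numerator_step (A S : comNzRingType) (f : {rmorphism A -> S})
    (H F G H' F' G' : A) (u Du w Dw : S) :
    w ^+ 2 = f F -> Dw * w *+ 2 = f F' -> f H' * u + f H * Du = f G' * w + f G * Dw ->
    f H * u = f G * w ->
  f (H * H * F * 2) * Du = f (H * F * G' * 2 + H * G * F' - H' * F * G * 2) * w.
Proof.
rewrite rmorphB rmorphD !rmorphM rmorph_nat => <- <- E1 E2.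
have -> : f H * f H * w ^+ 2 * 2 * Du = f H * w ^+ 2 * 2 * (f H * Du) by ring.
have -> : f H * Du = f G' * w + f G * Dw - f H' * u by rewrite -E1; ring.
have -> : f H * w ^+ 2 * 2 * (f G' * w + f G * Dw - f H' * u) =
  f H * w ^+ 2 * 2 * (f G' * w + f G * Dw) - f H' * w ^+ 2 * 2 * (f H * u) by ring.
by rewrite E2; ring.
Qed.

(** Multiply W h = s + t y by 2 c H: the left side becomes w W G, which lies in the
    image of f, and the coordinates in the basis 1, y can be compared. *)
Lemma clear_odd_denominators (A S : comNzRingType) (f : {rmorphism A -> S})
    (H G F s t : A) (w W h y : S) c :
    w * W = f F -> f H * (h *+ 2 *+ c) = f G * w -> W * h = f s + f t * y ->
  f (H * c%:R * 2 * s - G * F) + f (H * c%:R * 2 * t) * y = 0.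
Proof.
move=> wW HG E; rewrite rmorphB !rmorphM !rmorph_nat -wW.
rewrite (mulrA (f G)) -HG -[_ *+ c]mulr_natr.
transitivity (f H * c%:R * 2 * (f s + f t * y - W * h)); first by ring.
by rewrite E subrr mulr0.
Qed.

Section Derivation.
Context (R : idomainType) (P Q : {poly R}).
Hypothesis charR : forall n, n.+1%:R != 0 :> R.
Hypothesis F0 : P *+ 4 + Q ^+ 2 != 0.
Local Notation K := (funfield P Q).
Local Notation ff := (ffpoly P Q).
Local Notation y := (ffy P Q).
Local Notation x := (ffx P Q).
Local Notation w := (y *+ 2 + ff Q).
Context (D : K -> K).
Hypothesis DD : forall a b, D (a + b) = D a + D b.
Hypothesis DM : forall a b, D (a * b) = D a * b + a * D b.
Hypothesis Dc : forall c, D (ffconst P Q c) = 0.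
Hypothesis Dx : D x = 1.

Lemma ffpolyXn n a : ff (a ^+ n) = ff a ^+ n.
Proof. exact: (rmorphXn ff). Qed.

(** The operator D_n, for D in the role of D_1. *)
Definition hasse (n : nat) (f : K) : K := iter n D f / n`!%:R.

Lemma derivation0 : D 0 = 0.
Proof. by apply: (addrI (D 0)); rewrite -DD !addr0. Qed.

Lemma derivation_sum I (r : seq I) (F : I -> K) :
  D (\sum_(i <- r) F i) = \sum_(i <- r) D (F i).
Proof. exact: (big_morph D DD derivation0). Qed.

Lemma derivationMn f n : D (f *+ n) = D f *+ n.
Proof. by elim: n => [|n IHn]; rewrite ?mulr0n ?derivation0 // !mulrS DD IHn. Qed.

Lemma derivation_ffpoly a : D (ff a) = ff a^`().
Proof.
elim/poly_ind: a => [|a c IHa]; first by rewrite deriv0 !rmorph0 derivation0.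
rewrite derivD derivM derivX derivC mulr1 addr0.
by rewrite !(rmorphD ff) !(rmorphM ff) DD DM IHa Dx Dc mulr1 addr0.
Qed.

Lemma natr_fact_unit n : n`!%:R \is a @GRing.unit K.
Proof.
rewrite -[n`!]prednK ?fact_gt0 // -(rmorph_nat ff) ffpoly_unit //.
by rewrite -polyC_natr polyC_eq0.
Qed.

Lemma natrS_unit n : n.+1%:R \is a @GRing.unit K.
Proof. by rewrite -(rmorph_nat ff) ffpoly_unit // -polyC_natr polyC_eq0. Qed.

Lemma iter_derivation_hasse n f : iter n D f = hasse n f *+ n`!.
Proof. by rewrite -mulr_natr divrK ?natr_fact_unit. Qed.

Lemma hasse0 f : hasse 0 f = f.
Proof. by rewrite /hasse divr1. Qed.

Lemma hasseS n f : hasse n.+1 f *+ n.+1 = D (hasse n f).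
Proof.
apply: (mulIr (natr_fact_unit n)); rewrite [RHS]mulr_natr -derivationMn.
by rewrite -iter_derivation_hasse -iterS iter_derivation_hasse mulr_natr -mulrnA factS.
Qed.

Lemma hasseD n f h : hasse n (f + h) = hasse n f + hasse n h.
Proof.
rewrite /hasse -mulrDl; congr (_ * _).
by elim: n => // n IHn; rewrite !iterS IHn DD.
Qed.

Lemma hasseMn n f m : hasse n (f *+ m) = hasse n f *+ m.
Proof.
elim: m => [|m IHm]; last by rewrite !mulrS hasseD IHm.
by apply: (addrI (hasse n 0)); rewrite -hasseD !mulr0n !addr0.
Qed.

Lemma hasse_ffpoly n a : hasse n (ff a) = ff a^`N(n).
Proof.
rewrite /hasse; have -> : iter n D (ff a) = ff a^`(n).
  by elim: n => // n IHn; rewrite iterS IHn derivation_ffpoly derivnS.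
by rewrite nderivn_def rmorphMn -mulr_natr mulrK ?natr_fact_unit.
Qed.

(** The Leibniz rule without binomial coefficients.  Multiply by n + 1 and
    differentiate the case of n: the term of index i occurs i times from the left
    factor and n + 1 - i times from the right one. *)
Lemma hasseM n f h :
  hasse n (f * h) = \sum_(i < n.+1) hasse i f * hasse (n - i) h.
Proof.
elim: n => [|n IHn]; first by rewrite big_ord1 !hasse0.
apply: (mulIr (natrS_unit n)); rewrite mulr_natr hasseS IHn derivation_sum.
pose c i := hasse i f * hasse (n.+1 - i)%N h.
have -> : \sum_(i < n.+1) D (hasse i f * hasse (n - i) h) =
   \sum_(i < n.+1) c i.+1 *+ i.+1 + \sum_(i < n.+1) c i *+ (n.+1 - i).
  rewrite -big_split; apply: eq_bigr => -[i lei] _ /=.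
  rewrite DM -!hasseS /c subSS mulrnAl mulrnAr.
  by rewrite -subSn.
have -> : \sum_(i < n.+1) c i.+1 *+ i.+1 = \sum_(i < n.+2) c i *+ i.
  by rewrite [RHS]big_ord_recl mulr0n add0r.
have -> : \sum_(i < n.+1) c i *+ (n.+1 - i) = \sum_(i < n.+2) c i *+ (n.+1 - i).
  by rewrite [RHS]big_ord_recr /= subnn mulr0n addr0.
rewrite -big_split mulr_natr -sumrMnl; apply: eq_bigr => -[i lei] _ /=.
by rewrite -mulrnDr subnKC.
Qed.

Lemma w_sqr : w ^+ 2 = ff (P *+ 4 + Q ^+ 2).
Proof.
rewrite rmorphD rmorphMn /= ffpolyXn -ffy_curve; ring.
Qed.

Lemma w_unit : w \is a GRing.unit.
Proof. by rewrite -(unitrX_pos _ (n := 2)) // w_sqr ffpoly_unit. Qed.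

Lemma derivation_w : D w * w *+ 2 = ff (P *+ 4 + Q ^+ 2)^`().
Proof. by rewrite -derivation_ffpoly -w_sqr expr2 DM; ring. Qed.

(** D preserves the R(x)-line spanned by w = sqrt F.  Fractions are avoided by
    keeping a denominator H. *)
Lemma iter_derivation_ffpoly_w a n :
  exists H G, H != 0 /\ ff H * iter n D (ff a * w) = ff G * w.
Proof.
set F := P *+ 4 + Q ^+ 2; have nzF : F != 0 by exact: F0.
elim: n => [|n [H [G [H0 E]]]]; first by exists 1, a; rewrite oner_neq0 rmorph1 mul1r.
exists (H * H * F * 2), (H * F * G^`() * 2 + H * G * F^`() - H^`() * F * G * 2).
split; first by rewrite !mulf_neq0 // -polyC_natr polyC_eq0.
set u := iter n D _ in E *; rewrite iterS -/u.
have DE : ff H^`() * u + ff H * D u = ff G^`() * w + ff G * D w.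
  by rewrite -!derivation_ffpoly -!DM E.
exact: (numerator_step w_sqr derivation_w DE E).
Qed.

(** Put 2 y = w - Q.  Beyond the degree of x^i Q the operator D_n only sees x^i w,
    whose derivatives stay in w R(x), and w w^(2n-1) is a power of F. *)
Lemma ff_odd_part0 s t n i : (i + size Q <= n)%N -> (0 < n)%N ->
  w ^+ n.*2.-1 * hasse n (x ^+ i * y) = ff s + ff t * y -> t = 0.
Proof.
move=> sQ n0 E; have [H [G [H0 HG]]] := iter_derivation_ffpoly_w 'X^i n.
have sX : hasse n (x ^+ i * ff Q) = 0.
  rewrite -ffpolyXn -(rmorphM ff) hasse_ffpoly nderivn_poly0 ?rmorph0 //.
  by rewrite (leq_trans (size_polyMleq _ _)) // size_polyXn.
have E2 : hasse n (x ^+ i * y) *+ 2 = hasse n (ff 'X^i * w).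
  rewrite ffpolyXn mulrDr hasseD sX addr0 -hasseMn; congr hasse; by ring.
move: HG; rewrite iter_derivation_hasse -E2 => HG.
have wW : w * w ^+ n.*2.-1 = ff ((P *+ 4 + Q ^+ 2) ^+ n).
  by rewrite ffpolyXn -w_sqr -exprM mul2n -exprS prednK // double_gt0.
case/ffpoly_indep: (clear_odd_denominators wW HG E) => _ /eqP.
rewrite !mulf_eq0 (negPf H0) -!polyC_natr !polyC_eq0 (negPf (charR 1)) /=.
by rewrite -[n`!]prednK ?fact_gt0 // (negPf (charR _)) => /eqP.
Qed.

(** The D_j y are the Taylor coefficients of y, by the Leibniz rule applied to the
    equation of the curve. *)
Lemma hasse_num_generic i n : (i < n)%N ->
  w ^+ n.*2.-1 * hasse n (x ^+ i * y) = ffeval P Q (hasse_num P Q 'X^i n).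
Proof.
move=> ltin.
have -> : ffeval P Q (hasse_num P Q 'X^i n) =
    taylor_num_mul (fun i => ff P^`N(i)) (fun i => ff Q^`N(i)) y w (fun j => ff ('X^i)^`N(j)) n.
  have E := rmorph_hasse_num (ffeval P Q) P Q 'X^i n.
  rewrite E /= ffevalX ffevalC.
  by apply: eq_taylor_num_mul => j /=; rewrite ffevalC.
rewrite hasseM.
have -> : \sum_(j < n.+1) hasse j (x ^+ i) * hasse (n - j) y =
    \sum_(j < n.+1) ff ('X^i)^`N(j) * hasse (n - j) y.
  by apply: eq_bigr => j _; rewrite -ffpolyXn hasse_ffpoly.
rewrite (@taylor_num_mulP _ (fun i => ff P^`N(i)) (fun i => ff Q^`N(i)) y w (fun j => hasse j y)
  (fun j => ff ('X^i)^`N(j))).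
- by [].
- exact: hasse0.
- by rewrite nderivn0.
- by rewrite nderivn_poly0 ?rmorph0 // size_polyXn.
move=> m _; have -> : \sum_(j < m.+1) ff Q^`N(j) * hasse (m - j) y = hasse m (ff Q * y).
  by rewrite hasseM; apply: eq_bigr => j _; rewrite hasse_ffpoly.
by rewrite -hasseM -hasseD -expr2 ffy_curve hasse_ffpoly.
Qed.

(** Existence and uniqueness of s in the range where t vanishes: s is the
    remainder of [hasse_num] modulo the equation. *)
Lemma hasse_num_reduced i n : (i + size Q <= n)%N -> (i < n)%N ->
  exists s q, hasse_num P Q 'X^i n = s%:P + q * plane_curve P Q /\
    forall s' t', hasse n (x ^+ i * y) = (ff s' + ff t' * y) / w ^+ n.*2.-1 -> s' = s.
Proof.
move=> sQ ltin.
have [q [s [t E]]] := plane_curve_div P Q (hasse_num P Q 'X^i n).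
have wE := hasse_num_generic ltin.
have t0 : t = 0.
  apply: (ff_odd_part0 sQ (leq_ltn_trans _ ltin)) => //.
  rewrite wE E rmorphD rmorphM /= ffeval_curve mulr0 add0r.
  by rewrite rmorphD rmorphM /= !ffevalC ffevalX.
exists s, q; split; first by rewrite E t0 mul0r addr0 addrC.
move=> s' t' E'; move: wE; rewrite E' mulrC divrK; last by rewrite unitrX // w_unit.
rewrite E t0 rmorphD rmorphM /= ffeval_curve mulr0 mul0r addr0 add0r ffevalC => E2.
have [|/eqP] := @ffpoly_indep _ P Q (s' - s) t'.
  by rewrite rmorphB /= -E2; ring.
by rewrite subr_eq0 => /eqP.
Qed.

Lemma hasse_num_solution i n : (i < n)%N ->
  exists s t, hasse n (x ^+ i * y) = (ff s + ff t * y) / w ^+ n.*2.-1.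
Proof.
move=> ltin; have [q [s [t E]]] := plane_curve_div P Q (hasse_num P Q 'X^i n).
have wE := hasse_num_generic ltin.
exists s, t; apply: (mulrI (unitrX n.*2.-1 w_unit)).
rewrite wE [RHS]mulrC divrK ?unitrX ?w_unit //.
rewrite E rmorphD rmorphM /= ffeval_curve mulr0 add0r.
by rewrite rmorphD rmorphM /= !ffevalC ffevalX.
Qed.

End Derivation.

(** * The numerators s_(i,n) and their specialization *)

Lemma Lam_natS g n : n.+1%:R != 0 :> Lam g.
Proof. by rewrite -mpolyC_nat mpolyC_eq0 // Num.Theory.pnatr_eq0. Qed.

Lemma size_genQ g : (size (genQ g) <= g.+1)%N.
Proof.
apply: leq_trans (size_sum _ _ _) _; apply/bigmax_leqP => i _.
by rewrite mul_polyC (leq_trans (size_scale_leq _ _)) // size_polyXn.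
Qed.

Lemma genF_neq0 g : genP g *+ 4 + genQ g ^+ 2 != 0.
Proof.
apply/eqP => /polyP/(_ g.*2.+1)/eqP; rewrite coefD coefMn [X in _ + X]nth_default.
  rewrite /genP coefD coefXn eqxx coef_sum big1 => [|i _].
    by rewrite add0r addr0 coef0 (negPf (Lam_natS _ _)).
  by rewrite coefCM coefXn gtn_eqF ?mulr0.
by rewrite expr2 (leq_trans (size_polyMleq _ _)) //; have := size_genQ g; lia.
Qed.

(** Without a derivation as required of D_1, all D_n with n > 0 are the default
    value 0, and 0 = s + t y forces s = 0. *)
Lemma s_eq0 g i n : ~ (exists D, is_D1 (g := g) D) -> (0 < n)%N -> s_ g i n = 0.
Proof.
move=> noD n0; have D0 : D1 (g := g) = fun=> 0.
  by rewrite /D1 xgetPN // => D DD; apply: noD; exists D.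
have Dn0 f : Dn n f = 0 :> funfield (genP g) (genQ g).
  by rewrite /Dn D0 -[n]prednK // iterS mul0r.
rewrite /s_; case: xgetP => [[s t] _ /=|//].
set w := ffy (genP g) (genQ g) *+ 2 + ffpoly _ _ (genQ g).
rewrite /is_st Dn0 => /esym/(congr1 (fun z => z * w ^+ n.*2.-1)).
rewrite mul0r divrK ?unitrX ?w_unit ?genF_neq0 //.
by case/ffpoly_indep.
Qed.

(** This is how s_(i,n) leaves the function field: a congruence in Lambda[x, y]
    modulo the equation, which survives every specialization. *)
Lemma hasse_num_eq_s g i n : (exists D, is_D1 (g := g) D) -> (i + g < n)%N ->
  exists q, hasse_num (genP g) (genQ g) 'X^i n = (s_ g i n)%:P + q * plane_curve (genP g) (genQ g).
Proof.
move=> exD ltin; have [DD DM Dc Dx] : is_D1 (D1 (g := g)).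
  have [D DP] := exD; exact: (@xgetPex _ (fun=> 0) _ (ex_intro _ D DP)).
have ltin' : (i < n)%N by lia.
have sQ : (i + size (genQ g) <= n)%N by have := size_genQ g; lia.
have [s [q [E sP]]] := hasse_num_reduced (@Lam_natS g) (genF_neq0 g) DD DM Dc Dx sQ ltin'.
exists q; rewrite E; congr (_%:P + _); apply/esym.
rewrite /s_; case: xgetP => [[s1 t1] _ /=|]; first by move/sP.
have [s1 [t1 st]] := hasse_num_solution (@Lam_natS g) (genF_neq0 g) DD DM Dc Dx ltin'.
by move/(_ (s1, t1)) => /(_ st).
Qed.

Section Specialize.
Context (k : fieldType) (g : nat) (P Q : {poly k}).
Hypothesis (monicP : P \is monic) (degP : size P = g.*2.+2) (degQ : (size Q <= g.+1)%N).
Local Notation spec := (@specialize g k P Q).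

HB.instance Definition _ := GRing.RMorphism.copy spec
  (mmap intr (fun v : 'I_(g.*2.+1 + g.+1) =>
     match split v with inl i => P`_i | inr i => Q`_i end)).

Lemma specializeX v :
  spec 'X_v = match split v with inl i => P`_i | inr i => Q`_i end.
Proof. by rewrite /specialize mmapX mmap1U. Qed.

Lemma specialize_genP : map_poly spec (genP g) = P.
Proof.
rewrite /genP rmorphD rmorph_sum /= map_polyXn.
have -> : \sum_(i < g.*2.+1) map_poly spec (('X_(lshift g.+1 i))%:P * 'X^i) =
   \sum_(i < g.*2.+1) P`_i *: 'X^i.
  apply: eq_bigr => i _; rewrite rmorphM /= map_polyXn map_polyC /= specializeX.
  by rewrite (unsplitK (inl i)) mul_polyC.
have lP : P`_(g.*2.+1) = 1 by have := monicP; rewrite monicE lead_coefE degP => /eqP.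
rewrite -[in RHS](coefK P) poly_def degP [RHS]big_ord_recr /= lP scale1r.
by [].
Qed.

Lemma specialize_genQ : map_poly spec (genQ g) = Q.
Proof.
rewrite /genQ rmorph_sum /=.
have -> : \sum_(i < g.+1) map_poly spec (('X_(rshift g.*2.+1 i))%:P * 'X^i) =
   \sum_(i < g.+1) Q`_i *: 'X^i.
  apply: eq_bigr => i _; rewrite rmorphM /= map_polyXn map_polyC /= specializeX.
  by rewrite (unsplitK (inr i)) mul_polyC.
rewrite -poly_def; apply/polyP => i; rewrite coef_poly.
by case: ltnP => // /(leq_trans degQ) /leq_sizeP->.
Qed.

Lemma hasse_num_specialize (b : {poly k}) m n :
    (exists D, is_D1 (g := g) D) -> (size b <= m)%N -> (m + g <= n)%N ->
  exists q, hasse_num P Q b n =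
    (\sum_(l < m) b`_l *: map_poly spec (s_ g l n))%:P + q * plane_curve P Q.
Proof.
move=> exD sb mgn.
have /boolp.choice[q qE] (l : 'I_m) : exists q : {poly {poly k}},
    hasse_num P Q 'X^l n = (map_poly spec (s_ g l n))%:P + q * plane_curve P Q.
  have [|q E] := @hasse_num_eq_s g l n exD.
    by rewrite (leq_trans _ mgn) // ltn_add2r.
  exists (map_poly (map_poly spec) q).
  rewrite -[X in hasse_num X]specialize_genP -[X in hasse_num _ X]specialize_genQ.
  rewrite -['X^l](map_polyXn spec) -map_hasse_num E rmorphD rmorphM /= map_polyC.
  by rewrite map_plane_curve specialize_genP specialize_genQ.
exists (\sum_(l < m) (b`_l)%:P *: q l).
rewrite (hasse_num_sum _ _ _ sb) mulr_suml rmorph_sum -big_split /=.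
apply: eq_bigr => l _; rewrite qE scalerDr scalerAl; congr (_ + _).
by rewrite -mul_polyC -mul_polyC -polyCM.
Qed.
End Specialize.

(** * Local rings given by a chart *)

Section LocalRing.
Context (B : comNzRingType) (k : fieldType) (K : comUnitRingType).
Context (ev : {rmorphism B -> K}) (va : {rmorphism B -> k}).
Hypothesis ev_va0 : forall a, ev a = 0 -> va a = 0.
Hypothesis unitK : forall f : K, f != 0 -> f \is a GRing.unit.

(** These definitions repeat [regular_at], [local_unit], [max_ideal] and
    [uniformizer] for any ring B of functions on a chart, evaluated in a field by ev
    and at a point by va.  All points, including infinity, are instances. *)
Definition lregular (f : K) := exists a b, va b != 0 /\ f * ev b = ev a.
Definition lunit (f : K) := [/\ f \is a GRing.unit, lregular f & lregular f^-1].
Definition lmax (f : K) := lregular f /\ ~ lunit f.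
Definition luniformizer (t : K) :=
  t \is a GRing.unit /\ forall f, lmax f <-> exists2 h, lregular h & f = t * h.

Lemma ev_unit a : va a != 0 -> ev a \is a GRing.unit.
Proof. by move=> a0; apply: unitK; apply: contra_neq a0 => /ev_va0. Qed.

Lemma ev_eq a b : ev a = ev b -> va a = va b.
Proof.
by move=> /eqP; rewrite -subr_eq0 -rmorphB => /eqP/ev_va0/eqP; rewrite rmorphB subr_eq0 => /eqP.
Qed.

Lemma lregular_ev a : lregular (ev a).
Proof. by exists a, 1; rewrite !rmorph1 oner_neq0 mulr1. Qed.

Lemma lregularM f h : lregular f -> lregular h -> lregular (f * h).
Proof.
move=> [a [b [b0 fb]]] [c [d [d0 hd]]]; exists (a * c), (b * d).
by rewrite rmorphM mulf_neq0 // !rmorphM mulrACA fb hd.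
Qed.

Lemma lregularD f h : lregular f -> lregular h -> lregular (f + h).
Proof.
move=> [a [b [b0 fb]]] [c [d [d0 hd]]]; exists (a * d + c * b), (b * d).
rewrite rmorphM mulf_neq0 // rmorphD !rmorphM -fb -hd; split=> //; by ring.
Qed.

Lemma lregular1 : lregular 1.
Proof. by rewrite -(rmorph1 ev); exact: lregular_ev. Qed.

Lemma lregular_evV a : va a != 0 -> lregular (ev a)^-1.
Proof. by move=> a0; exists 1, a; rewrite rmorph1 mulVr // ev_unit. Qed.

Lemma lunit_ev a : va a != 0 -> lunit (ev a).
Proof. by move=> a0; split; [exact: ev_unit|exact: lregular_ev|exact: lregular_evV]. Qed.

Lemma lunitM f h : lunit f -> lunit h -> lunit (f * h).
Proof.
move=> [uf rf rf'] [uh rh rh']; split; [by rewrite unitrM uf|exact: lregularM|].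
by rewrite invrM // mulrC; exact: lregularM.
Qed.

Lemma lunitV f : lunit f -> lunit f^-1.
Proof. by move=> [uf rf rf']; split; rewrite ?unitrV ?invrK. Qed.

Lemma lunitX f n : lunit f -> lunit (f ^+ n).
Proof.
move=> uf; elim: n => [|n IHn]; last by rewrite exprS; exact: lunitM.
by rewrite expr0 -(rmorph1 ev); apply: lunit_ev; rewrite rmorph1 oner_neq0.
Qed.

Lemma lunitXz f (n : int) : lunit f -> lunit (f ^ n).
Proof.
by move=> uf; case: n => n; [exact: lunitX|rewrite NegzE -exprnN; exact/lunitV/lunitX].
Qed.

(** A unit has a nonzero value: multiply f ev b = ev a by an equation
    f^-1 ev d = ev c and evaluate at the point. *)
Lemma lunit_neq0 f a b : lunit f -> va b != 0 -> f * ev b = ev a -> va a != 0.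
Proof.
move=> [uf _ [c [d [d0 fd]]]] b0 fb; apply: contra_neq (mulf_neq0 b0 d0) => a0.
rewrite -rmorphM (@ev_eq _ (a * c)) ?rmorphM ?a0 ?mul0r //.
by rewrite -fb -fd mulrACA divrr // mul1r.
Qed.

Lemma lmaxP f : lmax f <-> exists a b, [/\ va b != 0, va a = 0 & f * ev b = ev a].
Proof.
split=> [[[a [b [b0 fb]]] Nuf]|[a [b [b0 a0 fb]]]].
  exists a, b; split=> //; apply/eqP/negPn/negP => a0; apply: Nuf.
  have -> : f = ev a * (ev b)^-1 by rewrite -fb mulrK // ev_unit.
  by apply/lunitM/lunitV; exact: lunit_ev.
split; first by exists a, b.
by move=> /lunit_neq0 /(_ b0 fb); rewrite a0 eqxx.
Qed.

(** u0 and v0 generate the ideal of the point in B, so an element that divides both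
    in the local ring generates the maximal ideal. *)
Lemma luniformizer_gen (u0 v0 t : B) (hu hv : K) :
    (forall a, va a = 0 -> exists a1 a2, a = a1 * u0 + a2 * v0) ->
    va t = 0 -> ev t \is a GRing.unit ->
    lregular hu -> ev u0 = ev t * hu -> lregular hv -> ev v0 = ev t * hv ->
  luniformizer (ev t).
Proof.
move=> gen t0 ut ru uE rv vE; split=> // f.
split=> [/lmaxP[a [b [b0 a0 fb]]]|[h [a [b [b0 hb]]] ->]].
  have [a1 [a2 aE]] := gen a a0.
  exists ((ev a1 * hu + ev a2 * hv) / ev b).
    apply: lregularM; last exact: lregular_evV.
    by apply: lregularD; apply: lregularM => //; exact: lregular_ev.
  rewrite mulrA; apply: (mulIr (ev_unit b0)); rewrite divrK ?ev_unit // fb aE.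
  by rewrite rmorphD !rmorphM uE vE; ring.
apply/lmaxP; exists (t * a), b; split=> //; first by rewrite rmorphM t0 mul0r.
by rewrite -mulrA hb rmorphM.
Qed.

Lemma luniformizer_assoc t t' : luniformizer t -> luniformizer t' -> lunit (t / t').
Proof.
move=> [ut tP] [ut' tP'].
have mt : lmax t by apply/tP; exists 1; rewrite ?mulr1 //; exact: lregular1.
have mt' : lmax t' by apply/tP'; exists 1; rewrite ?mulr1 //; exact: lregular1.
split; first by rewrite unitrM ut unitrV.
  by have /tP'[h rh ->] := mt; rewrite mulrAC divrr // mul1r.
by rewrite invrM ?unitrV // invrK; have /tP[h rh ->] := mt'; rewrite mulrAC divrr // mul1r.
Qed.

(** The order does not depend on the uniformizer, two of which differ by a unit. *)
Lemma lorder_intro t t' f (n : int) : luniformizer t -> luniformizer t' ->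
  lunit (f / t ^ n) -> lunit (f / t' ^ n).
Proof.
move=> ut ut' uf; have := lunitM uf (lunitXz n (luniformizer_assoc ut ut')).
have [t0 t0'] := (ut.1, ut'.1).
rewrite exprMz_comm ?unitrV //; last exact: mulrC.
by rewrite exprz_inv -invr_expz mulrA divrK ?unitrXz.
Qed.

End LocalRing.

(** * Uniformizers on a plane curve *)

Section PlaneChart.
Context (k : fieldType) (K : comUnitRingType).
Context (ev : {rmorphism {poly {poly k}} -> K}) (va : {rmorphism {poly {poly k}} -> k}).
Context (u1 v1 : k) (Pc Qc : {poly k}).
Hypothesis vaE : forall a, va a = a.[v1%:P].[u1].
Hypothesis ev_va0 : forall a, ev a = 0 -> va a = 0.
Hypothesis unitK : forall f : K, f != 0 -> f \is a GRing.unit.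
Hypothesis ev_curve : ev (plane_curve Pc Qc) = 0.
Hypothesis on_curve : v1 ^+ 2 + Qc.[u1] * v1 = Pc.[u1].

Definition du : {poly {poly k}} := ('X - u1%:P)%:P.
Definition dv : {poly {poly k}} := 'X - v1%:P%:P.

Lemma va_C p : va p%:P = p.[u1]. Proof. by rewrite vaE hornerC. Qed.
Lemma va_du : va du = 0. Proof. by rewrite va_C hornerXsubC subrr. Qed.
Lemma va_dv : va dv = 0. Proof. by rewrite vaE hornerXsubC subrr horner0. Qed.

(** Divide by y - v1, then divide the remainder by x - u1. *)
Lemma va0_gen a : va a = 0 -> exists a1 a2, a = a1 * du + a2 * dv.
Proof.
rewrite vaE => /eqP/factor_theorem[b bE].
have /factor_theorem[c cE] : root (a - (a.[v1%:P])%:P) v1%:P.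
  by rewrite /root hornerD hornerN hornerC subrr.
exists b%:P, c; rewrite -[LHS](subrK (a.[v1%:P])%:P) cE bE polyCM addrC //.
Qed.

(** The equation at (u1, v1), shifted to the origin: P - v1 Q - v1^2 and Q - Q(u1)
    are divisible by x - u1, and the value of the first quotient is the
    x-derivative of the equation, up to sign. *)
Lemma curve_shift : exists p1 q1 : {poly k},
  [/\ p1 * ('X - u1%:P) = Pc - v1 *: Qc - (v1 ^+ 2)%:P,
      q1 * ('X - u1%:P) = Qc - Qc.[u1]%:P &
      p1.[u1] = Pc^`().[u1] - Qc^`().[u1] * v1].
Proof.
have /factor_theorem[p1 p1E] : root (Pc - v1 *: Qc - (v1 ^+ 2)%:P) u1.
  by rewrite /root !hornerE -on_curve; apply/eqP; ring.
have /factor_theorem[q1 q1E] : root (Qc - Qc.[u1]%:P) u1.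
  by rewrite /root !hornerE subrr.
exists p1, q1; split=> //.
have := congr1 (fun p => p^`().[u1]) p1E; rewrite !derivE !hornerE.
by rewrite subrr mulr0 add0r => <-; ring.
Qed.

(** The conjugate of y - v1 is -(y + v1 + Q), and their product is the
    norm of y - v1, a polynomial in x that vanishes at u1. *)
Lemma ev_dv_conj p1 : p1 * ('X - u1%:P) = Pc - v1 *: Qc - (v1 ^+ 2)%:P ->
  ev dv * ev ('X + (v1%:P + Qc)%:P) = ev du * ev p1%:P.
Proof.
move=> p1E; rewrite -!(rmorphM ev) -[LHS]subr0 -ev_curve -rmorphB; congr (ev _).
have -> : du * p1%:P = (Pc - v1 *: Qc - (v1 ^+ 2)%:P)%:P by rewrite -polyCM mulrC p1E.
by rewrite /dv /plane_curve -mul_polyC !(polyCD, polyCN, polyCM); ring.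
Qed.

Hypothesis du_unit : ev du \is a GRing.unit.

(** The conjugate factor of y - v1 does not vanish at the point, so x - u1 divides
    y - v1. *)
Lemma uniformizer_abscissa : v1 *+ 2 + Qc.[u1] != 0 -> luniformizer ev va (ev du).
Proof.
move=> w1; have [p1 [q1 [p1E _ _]]] := curve_shift.
have cE := ev_dv_conj p1E; set c := 'X + _ in cE.
have c0 : va c != 0 by rewrite vaE !hornerE.
apply: (luniformizer_gen ev_va0 unitK va0_gen va_du du_unit (lregular1 ev va) _
  (lregularM (lregular_ev ev va p1%:P) (lregular_evV ev_va0 unitK c0))).
  by rewrite mulr1.
by rewrite mulrA -cE mulrK // (ev_unit ev_va0 unitK).
Qed.

(** Here y - v1 is its own conjugate up to a multiple of x - u1; by smoothness the
    cofactor of x - u1 is a unit, so x - u1 has a double zero. *)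
Lemma uniformizer_ordinate : v1 *+ 2 + Qc.[u1] = 0 ->
    Pc^`().[u1] != Qc^`().[u1] * v1 ->
  luniformizer ev va (ev dv) /\
  exists2 z, va z != 0 & ev dv ^+ 2 = ev du * ev z.
Proof.
move=> w1 smooth; have [p1 [q1 [p1E q1E p1u]]] := curve_shift.
have p10 : va p1%:P != 0 by rewrite va_C p1u subr_eq0.
have cE := ev_dv_conj p1E; set c := 'X + _ in cE.
have uc : ev dv * ev c \is a GRing.unit.
  by rewrite cE unitrM du_unit (ev_unit ev_va0 unitK).
have udv : ev dv \is a GRing.unit by move: uc; rewrite unitrM => /andP[].
split.
  apply: (luniformizer_gen ev_va0 unitK va0_gen va_dv udv
    (lregularM (lregular_ev ev va c) (lregular_evV ev_va0 unitK p10)) _ (lregular1 ev va) _).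
    by rewrite mulrA cE mulrK // (ev_unit ev_va0 unitK).
  by rewrite mulr1.
exists (p1%:P - q1%:P * dv).
  by rewrite rmorphB rmorphM va_dv mulr0 subr0.
have cE2 : c = dv + du * q1%:P.
  have w1' : Qc.[u1] = - (v1 *+ 2) by apply/eqP; rewrite -addr_eq0 addrC w1.
  by rewrite -polyCM mulrC q1E w1' /c /dv mulr2n !(polyCD, polyCN); ring.
have -> : ev (p1%:P - q1%:P * dv) = ev p1%:P - ev q1%:P * ev dv.
  by rewrite rmorphB rmorphM.
have cE3 : ev c = ev dv + ev du * ev q1%:P by rewrite cE2 rmorphD rmorphM.
by rewrite mulrBr -cE cE3; ring.
Qed.
End PlaneChart.

(** * The two charts of the curve *)

(** This is the norm of a + b y.  Its two candidates for the leading term, from a^2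
    and from b^2 P, have degrees of different parities. *)
Lemma quadratic_norm_neq0 (R : idomainType) g (P Q a b : {poly R}) :
    size P = g.*2.+2 -> (size Q <= g.+1)%N -> (a != 0) || (b != 0) ->
  a ^+ 2 - a * b * Q - b ^+ 2 * P != 0.
Proof.
move=> sP sQ; have P0 : P != 0 by rewrite -size_poly_eq0 sP.
have [-> /=|b0 _] := eqVneq b 0.
  by rewrite orbF mulr0 !mul0r !expr0n /= !mul0r !subr0 => a0; rewrite expf_neq0.
have sb : (0 < size b)%N by rewrite lt0n size_poly_eq0.
have sbP : size (b ^+ 2 * P) = (size b + size b + g.*2)%N.
  by rewrite expr2 !size_mul ?mulf_neq0 // sP; lia.
apply/negP => /eqP/eqP; rewrite subr_eq0 expr2 -mulrA -mulrBr => /eqP E.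
have : size (a * (a - b * Q)) = (size b + size b + g.*2)%N by rewrite E sbP.
have sbQ : (size (b * Q)%R <= size b + g)%N.
  by rewrite (leq_trans (size_polyMleq _ _)) //; lia.
have [le|lt] := leqP (size a) (size b + g).
  have := size_polyMleq a (a - b * Q).
  have : (size (a - b * Q)%R <= size b + g)%N.
    by rewrite (leq_trans (size_polyD _ _)) // size_polyN geq_max le.
  lia.
have -> : size (a * (a - b * Q)) = (size a + size a).-1.
  have sa : size (a - b * Q) = size a.
    by rewrite size_polyDl // size_polyN (leq_ltn_trans sbQ).
  have a0 : a != 0 by rewrite -size_poly_gt0; lia.
  by rewrite size_mul -?size_poly_eq0 ?sa ?size_poly_eq0 //.
lia.
Qed.

Lemma quadratic_norm (A S : comNzRingType) (f : {rmorphism A -> S}) (a b P Q : A) (y : S) :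
    f P = y ^+ 2 + f Q * y ->
  (f a + f b * y) * (f (a - b * Q) - f b * y) = f (a ^+ 2 - a * b * Q - b ^+ 2 * P).
Proof.
by move=> E; rewrite !expr2 !rmorphB !rmorphM E; ring.
Qed.

(** u^n s(1/u): reversal of coefficients relative to the degree bound n. *)
Definition rev_poly (R : nzSemiRingType) n (s : {poly R}) : {poly R} :=
  \poly_(i < n.+1) s`_(n - i).

Lemma rev_polyK (R : nzSemiRingType) n (s : {poly R}) :
  (size s <= n.+1)%N -> rev_poly n (rev_poly n s) = s.
Proof.
move=> ss; apply/polyP => i; rewrite !coef_poly; case: ltnP => [lti|/(leq_trans ss)].
  by rewrite ltnS leq_subr subKn.
by move/leq_sizeP => ->.
Qed.

Lemma rev_poly_horner (R : nzRingType) (S : comUnitRingType)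
    (f : {rmorphism R -> S}) n (s : {poly R}) x :
    x \is a GRing.unit -> (size s <= n.+1)%N ->
  (map_poly f (rev_poly n s)).[x^-1] * x ^+ n = (map_poly f s).[x].
Proof.
move=> ux ss; rewrite (horner_coef_wide _ (n := n.+1)); last first.
  by rewrite (leq_trans (size_poly _ _)) // size_poly.
rewrite (horner_coef_wide _ (n := n.+1)); last first.
  by rewrite (leq_trans (size_poly _ _)).
rewrite mulr_suml [RHS](reindex_inj rev_ord_inj); apply: eq_bigr => -[i lei] _ /=.
rewrite !coef_map coef_poly lei subSS -mulrA exprVn; congr (_ * _).
have -> : x ^+ n = x ^+ (n - i) * x ^+ i by rewrite -exprD subnK.
by rewrite mulrCA mulVr ?unitrX // mulr1.
Qed.

Section Charts.
Context (k : fieldType) (g : nat) (P Q : {poly k}).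
Hypothesis (degP : size P = g.*2.+2) (degQ : (size Q <= g.+1)%N).
Local Notation K := (funfield P Q).
Local Notation ff := (ffpoly P Q).
Local Notation y := (ffy P Q).
Local Notation x := (ffx P Q).

Lemma funfield_norm a b :
  (ff a + ff b * y) * (ff (a - b * Q) - ff b * y) = ff (a ^+ 2 - a * b * Q - b ^+ 2 * P).
Proof.
exact: (@quadratic_norm _ _ (ffpoly P Q) a b P Q y (esym (ffy_curve P Q))).
Qed.

(** The conjugate of a + b y divides its norm, a nonzero element of R(x). *)
Lemma funfield_unit (f : K) : f != 0 -> f \is a GRing.unit.
Proof.
move=> f0; have [d [a [b [d0 dE]]]] := funfield_decomp f.
have : (a != 0) || (b != 0).
  rewrite -negb_and; apply: contraNN f0 => /andP[/eqP a0 /eqP b0].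
  rewrite -[f](mulKr (ffpoly_unit P Q d0)) dE a0 b0 rmorph0 mul0r addr0 mulr0 //.
move=> /(quadratic_norm_neq0 degP degQ) /(ffpoly_unit P Q).
by rewrite -funfield_norm -dE !unitrM => /andP[/andP[]].
Qed.

Lemma horner_ffx s : (map_poly (ffconst P Q) s).[x] = ff s.
Proof.
elim/poly_ind: s => [|s c IHs]; first by rewrite map_poly0 horner0 rmorph0.
by rewrite rmorphD rmorphM /= map_polyX map_polyC hornerMXaddC IHs rmorphD rmorphM.
Qed.

Lemma ffx_unit : x \is a GRing.unit.
Proof. by rewrite ffpoly_unit // polyX_eq0. Qed.

HB.instance Definition _ (xi : point P Q) := GRing.RMorphism.copy (eval_chart g xi)
  (horner_eval (chart g xi).2 \o map_poly (horner_eval (chart g xi).1 \o map_poly (ffconst P Q))).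
HB.instance Definition _ (xi : point P Q) := GRing.RMorphism.copy (eval_val xi)
  (horner_eval (chart_val xi).2 \o map_poly (horner_eval (chart_val xi).1 \o map_poly idfun)).

Lemma eval_valE (xi : point P Q) a :
  eval_val xi a = a.[(chart_val xi).2%:P].[(chart_val xi).1].
Proof.
rewrite -[LHS]/(horner_eval (chart_val xi).2
  (map_poly (horner_eval (chart_val xi).1 \o map_poly idfun) a)).
rewrite /horner_eval; have -> : map_poly (horner_eval (chart_val xi).1 \o map_poly idfun) a =
    map_poly (horner_eval (chart_val xi).1) a.
  by apply: eq_map_poly => c /=; rewrite map_poly_id.
by rewrite -[RHS]/(horner_eval _ _) -horner_map /= /horner_eval hornerC.
Qed.

Lemma eval_chartC (xi : point P Q) c :
  eval_chart g xi c%:P = (map_poly (ffconst P Q) c).[(chart g xi).1].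
Proof.
rewrite -[LHS]/(horner_eval (chart g xi).2
  (map_poly (horner_eval (chart g xi).1 \o map_poly (ffconst P Q)) c%:P)).
by rewrite map_polyC /= /horner_eval hornerC.
Qed.

Lemma eval_chartX (xi : point P Q) : eval_chart g xi 'X = (chart g xi).2.
Proof.
rewrite -[LHS]/(horner_eval (chart g xi).2
  (map_poly (horner_eval (chart g xi).1 \o map_poly (ffconst P Q)) 'X)).
by rewrite map_polyX /horner_eval hornerX.
Qed.

Lemma eval_chart_affine a c : eval_chart g (Some a : point P Q) c = ffeval P Q c.
Proof.
rewrite -[LHS]/(horner_eval y (map_poly (horner_eval x \o map_poly (ffconst P Q)) c)).
rewrite /ffeval /horner_eval; congr (_.[_]); apply: eq_map_poly => s /=.
by rewrite /horner_eval horner_ffx.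
Qed.

(** The equation satisfied by the chart coordinates: at infinity it is obtained
    from the affine one by dividing by x^(2g+2). *)
Definition chartP (xi : point P Q) := if xi is Some _ then P else rev_poly g.*2.+2 P.
Definition chartQ (xi : point P Q) := if xi is Some _ then Q else rev_poly g.+1 Q.

Lemma eval_chart_infty c : eval_chart g (infty P Q) c%:P = (map_poly (ffconst P Q) c).[x^-1].
Proof. exact: eval_chartC. Qed.

Lemma chart_curve (xi : point P Q) : eval_chart g xi (plane_curve (chartP xi) (chartQ xi)) = 0.
Proof.
case: xi => [a|]; first by rewrite eval_chart_affine ffeval_curve.
rewrite /plane_curve (expr2 'X) rmorphB rmorphD !rmorphM /= eval_chartX !eval_chartC /=.
apply: (mulIr (unitrX (g.*2.+2) ffx_unit)); rewrite mul0r.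
set Qx := (map_poly _ _).[_]; set Px := (map_poly _ _).[_].
have PE : Px * x ^+ g.*2.+2 = ff P.
  by rewrite -horner_ffx rev_poly_horner ?ffx_unit // degP.
have QE : Qx * x ^+ g.+1 = ff Q.
  by rewrite -horner_ffx rev_poly_horner ?ffx_unit // ltnW.
have -> : g.*2.+2 = (g.+1 + g.+1)%N by lia.
have zE : y / x ^+ g.+1 * x ^+ g.+1 = y by rewrite divrK // unitrX // ffx_unit.
move: PE; have -> : g.*2.+2 = (g.+1 + g.+1)%N by lia.
rewrite !exprD; move: (x ^+ g.+1) QE zE => X QE zE PE.
transitivity (y ^+ 2 + ff Q * y - ff P); last by rewrite ffy_curve subrr.
by rewrite -{}PE -{}QE -[in RHS]zE; ring.
Qed.

Lemma chart_val_curve (xi : point P Q) :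
  (chart_val xi).2 ^+ 2 + (chartQ xi).[(chart_val xi).1] * (chart_val xi).2 =
  (chartP xi).[(chart_val xi).1].
Proof.
case: xi => [[[x1 y1] /= /eqP//]|] /=.
rewrite horner_coef0 mulr0 addr0 expr0n /= horner_coef0 coef_poly /= subn0.
by rewrite nth_default // degP.
Qed.

(** Evaluation at a point factors through the ring of the chart.  At infinity, a
    relation s(1/x) + t(1/x) y/x^(g+1) = 0 becomes polynomial after multiplication
    by a power of x. *)
Lemma chart_kernel (xi : point P Q) c : eval_chart g xi c = 0 -> eval_val xi c = 0.
Proof.
have cv0 q : eval_val xi (q * plane_curve (chartP xi) (chartQ xi)) = 0.
  rewrite eval_valE /plane_curve !hornerE /=.
  by rewrite chart_val_curve subrr mulr0.
case: xi cv0 => [a|] cv0.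
  by rewrite eval_chart_affine => /ffeval_eq0[q ->]; exact: cv0.
have [q [s [t ->]]] := plane_curve_div (rev_poly g.*2.+2 P) (rev_poly g.+1 Q) c.
rewrite !rmorphD /= cv0 add0r rmorphM /= chart_curve mulr0 add0r.
rewrite rmorphM /= eval_chartX !eval_chart_infty !eval_valE /= !hornerE.
set n := maxn (size s) (size t) => E.
have revE m (r : {poly k}) : (size r <= m.+1)%N ->
    (map_poly (ffconst P Q) r).[x^-1] * x ^+ m = ff (rev_poly m r).
  move=> sr; rewrite -{1}(rev_polyK sr) rev_poly_horner ?ffx_unit ?horner_ffx //.
  exact: size_poly.
have ss : (size s <= (n + g.+1).+1)%N by rewrite /n; lia.
have st : (size t <= n.+1)%N by rewrite /n; lia.
have [|s0 _] := @ffpoly_indep _ P Q (rev_poly (n + g.+1) s) (rev_poly n t).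
  rewrite -!revE // exprD; move: E; set su := _.[_]; set tu := _.[_].
  have zE : y / x ^+ g.+1 * x ^+ g.+1 = y by rewrite divrK // unitrX // ffx_unit.
  move: zE; set z := y / _ => zE E; rewrite -zE.
  transitivity ((su + tu * z) * (x ^+ n * x ^+ g.+1)); last first.
    have -> : su + tu * z = 0 by rewrite /z mulrA; exact: E.
    exact: mul0r.
  by move: (x ^+ g.+1) (x ^+ n) z su tu {E zE} => X Y z su tu; ring.
by rewrite -(rev_polyK ss) s0 /rev_poly horner_coef0 coef_poly coef0.
Qed.

End Charts.

(** * Uniformizers at the points of the curve *)

Section Uniformizers.
Context (k : fieldType) (g : nat) (P Q : {poly k}).
Hypothesis (monicP : P \is monic) (degP : size P = g.*2.+2) (degQ : (size Q <= g.+1)%N).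
Hypothesis (smoothPQ : smooth_affine P Q).
Local Notation K := (funfield P Q).
Local Notation ff := (ffpoly P Q).
Local Notation y := (ffy P Q).
Local Notation x := (ffx P Q).
Local Notation pt := (point P Q).

Let fu := funfield_unit degP degQ.
Let ker (xi : pt) := chart_kernel degP degQ (xi := xi).

Lemma local_unit_eval (xi : pt) c : eval_val xi c != 0 -> local_unit g xi (eval_chart g xi c).
Proof. exact: (lunit_ev (@ker xi) fu). Qed.

Lemma regular_at_eval (xi : pt) c : regular_at g xi (eval_chart g xi c).
Proof. by exists c, 1; rewrite eval_val1 oner_neq0 -eval_chartM mulr1. Qed.

Lemma uniformizer_of_abscissa (a : affine_point P Q) :
  (val a).2 *+ 2 + Q.[(val a).1] != 0 ->
  uniformizer g (Some a : pt) (ff ('X - (val a).1%:P)).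
Proof.
move=> wa; set xi : pt := Some a.
have E : eval_chart g xi (du (val a).1) = ff ('X - (val a).1%:P).
  by rewrite eval_chart_affine ffevalC.
have ud : eval_chart g xi (du (val a).1) \is a GRing.unit.
  by rewrite E ffpoly_unit ?polyXsubC_eq0.
rewrite -E; exact: (uniformizer_abscissa (eval_valE xi) (@ker xi) fu
  (chart_curve degP degQ xi) (chart_val_curve degP xi) ud wa).
Qed.

Lemma uniformizer_of_ordinate (a : affine_point P Q) :
    (val a).2 *+ 2 + Q.[(val a).1] = 0 ->
  exists t z, [/\ uniformizer g (Some a : pt) t, eval_val (Some a : pt) z != 0 &
    t ^+ 2 = ff ('X - (val a).1%:P) * eval_chart g (Some a : pt) z].
Proof.
move=> wa; set xi : pt := Some a.
have E : eval_chart g xi (du (val a).1) = ff ('X - (val a).1%:P).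
  by rewrite eval_chart_affine ffevalC.
have ud : eval_chart g xi (du (val a).1) \is a GRing.unit.
  by rewrite E ffpoly_unit ?polyXsubC_eq0.
have sm : P^`().[(val a).1] != Q^`().[(val a).1] * (val a).2.
  apply/eqP => sE; apply: (smoothPQ (x0 := (val a).1) (y0 := (val a).2)) => //.
  by apply/eqP; exact: (valP a).
have [ut [z z0 zE]] := uniformizer_ordinate (eval_valE xi) (@ker xi) fu
  (chart_curve degP degQ xi) (chart_val_curve degP xi) ud wa sm.
by exists (eval_chart g xi (dv (val a).2)), z; split=> //; rewrite -E.
Qed.

(** The reversed polynomials satisfy Q(0) = 0, P(0) = 0 and P'(0) = 1, so the
    origin is a ramification point and v is a uniformizer. *)
Lemma uniformizer_at_infty :
  uniformizer g (infty P Q) (y / x ^+ g.+1) /\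
  exists2 z, eval_val (infty P Q) z != 0 &
    (y / x ^+ g.+1) ^+ 2 = x^-1 * eval_chart g (infty P Q) z.
Proof.
set xi := infty P Q.
have dE : eval_chart g xi (du 0) = x^-1.
  by rewrite eval_chart_infty subr0 map_polyX hornerX.
have vE : eval_chart g xi (dv 0) = y / x ^+ g.+1.
  by rewrite /dv !rmorph0 subr0 eval_chartX.
have ud : eval_chart g xi (du 0) \is a GRing.unit by rewrite dE unitrV ffx_unit.
have wa : 0 *+ 2 + (rev_poly g.+1 Q).[0] = 0.
  by rewrite mul0rn add0r horner_coef0 coef_poly subn0 nth_default.
have sm : (rev_poly g.*2.+2 P)^`().[0] != (rev_poly g.+1 Q)^`().[0] * 0.
  rewrite mulr0 horner_coef0 coef_deriv coef_poly /= mulr1n subn1 /=.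
  by have := monicP; rewrite monicE lead_coefE degP => /eqP ->; exact: oner_neq0.
have [ut [z z0 zE]] := uniformizer_ordinate (eval_valE xi) (@ker xi) fu
  (chart_curve degP degQ xi) (chart_val_curve degP xi) ud wa sm.
rewrite -vE; split=> //; by exists z => //; rewrite zE -dE.
Qed.

Lemma has_order_intro (xi : pt) t f n :
  uniformizer g xi t -> local_unit g xi (f / t ^ n) -> has_order g xi f n.
Proof.
move=> ut uf t' ut'.
exact: (lorder_intro (@ker xi) fu ut ut' uf).
Qed.

End Uniformizers.

(** * Torsion and principal divisors *)

Section Torsion.
Local Open Scope quotient_scope.
Context (k : fieldType) (g : nat) (P Q : {poly k}).
Local Notation pt := (point P Q).

Lemma abel_jacobiMn (xi : pt) n :
  abel_jacobi g xi *+ n = \pi_(jacobian g P Q) (Div0 (degree_zero_sub_infty xi) *+ n).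
Proof.
rewrite /abel_jacobi; elim: n => [|n IHn]; first by rewrite !mulr0n /jacobian piE.
by rewrite !mulrS IHn [RHS]Quotient.pi_add.
Qed.

Lemma torsionP (xi : pt) n : torsion n (abel_jacobi g xi) <->
  exists2 f : funfield P Q, f \is a GRing.unit &
    forall eta : pt, has_order g eta f ((xi == eta)%:R *+ n - (infty P Q == eta)%:R *+ n).
Proof.
have -> : torsion n (abel_jacobi g xi) =
   (Div0 (degree_zero_sub_infty xi) *+ n \in principal g (P := P) (Q := Q)).
  apply/propext; rewrite /torsion /= abel_jacobiMn -[X in X \in _]subr0.
  rewrite Quotient.idealrBE; split=> [E|/eqP E].
    by apply/eqP; rewrite E /jacobian piE.
  by rewrite /jacobian E piE.
have cE (eta : pt) : coeff eta (div_of (Div0 (degree_zero_sub_infty xi) *+ n)) =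
   (xi == eta)%:R *+ n - (infty P Q == eta)%:R *+ n.
  have -> : div_of (Div0 (degree_zero_sub_infty xi) *+ n) =
      (<< xi >> - << infty P Q >>) *+ n by exact: (raddfMn val).
  by rewrite coeffMn coeffB !coeffU mulrnBl !mul1r.
rewrite unfold_in; split=> [/asboolP[f uf fE]|[f uf fE]].
  by exists f => // eta; rewrite -cE.
by apply/asboolP; exists f => // eta; rewrite cE.
Qed.
End Torsion.

(** * Ramification points are 2-torsion *)

Section Orders.
Context (k : fieldType) (g : nat) (P Q : {poly k}).
Hypothesis (monicP : P \is monic) (degP : size P = g.*2.+2) (degQ : (size Q <= g.+1)%N).
Hypothesis (smoothPQ : smooth_affine P Q).
Local Notation K := (funfield P Q).
Local Notation ff := (ffpoly P Q).
Local Notation y := (ffy P Q).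
Local Notation x := (ffx P Q).
Local Notation pt := (point P Q).

Lemma local_unitV (xi : pt) (f : K) : local_unit g xi f -> local_unit g xi f^-1.
Proof. exact: lunitV. Qed.

(** [has_order] only constrains f when uniformizers exist, which is what smoothness
    provides. *)
Lemma exists_uniformizer (xi : pt) : exists t : K, uniformizer g xi t.
Proof.
case: xi => [a|]; last by case: (uniformizer_at_infty monicP degP degQ) => ut _; eexists; exact: ut.
have [w0|w0] := eqVneq ((val a).2 *+ 2 + Q.[(val a).1]) 0.
  by have [t [z [ut _ _]]] := uniformizer_of_ordinate degP degQ smoothPQ w0; exists t.
by eexists; exact: (uniformizer_of_abscissa degP degQ w0).
Qed.

Lemma has_order0 (xi : pt) (f : K) : has_order g xi f 0 <-> local_unit g xi f.
Proof.
split=> [fo|uf t _]; last by rewrite expr0z divr1.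
by have [t ut] := exists_uniformizer xi; have := fo t ut; rewrite expr0z divr1.
Qed.

(** The divisor of x - x0 is 2 [a] - 2 [infty]. *)
Lemma two_torsion_of_ramified (a : affine_point P Q) :
  (val a).2 *+ 2 + Q.[(val a).1] = 0 -> torsion 2 (abel_jacobi g (Some a : pt)).
Proof.
move=> w0; apply/torsionP; set x0 := (val a).1 in w0 *.
have uf : ff ('X - x0%:P) \is a GRing.unit by rewrite ffpoly_unit ?polyXsubC_eq0.
exists (ff ('X - x0%:P)) => // -[b|].
  rewrite (_ : infty P Q == Some b = false) // mul0rn subr0.
  have [ab|ab] := eqVneq (Some a : pt) (Some b).
    rewrite -ab {b ab}; have [t [z [ut z0 zE]]] := uniformizer_of_ordinate degP degQ smoothPQ w0.
    apply: (has_order_intro degP degQ ut).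
    have u2 : t ^+ 2 \is a GRing.unit by rewrite unitrX // ut.1.
    have -> : ff ('X - x0%:P) / t ^ (1%R *+ 2 : int) = (eval_chart g (Some a : pt) z)^-1.
      apply: (mulIr u2); rewrite divrK // zE mulrCA mulVr ?mulr1 //.
      by have [] := local_unit_eval degP degQ z0.
    by apply/local_unitV; exact: local_unit_eval.
  rewrite mul0rn; apply/has_order0.
  have <- : eval_chart g (Some b : pt) ('X - x0%:P)%:P = ff ('X - x0%:P).
    by rewrite eval_chart_affine ffevalC.
  apply: local_unit_eval => //; rewrite eval_valE hornerC /= hornerXsubC subr_eq0.
  apply: contraNneq ab => xb; apply/eqP; congr Some; apply: val_inj.
  have /eqP ea := valP a; have /eqP eb := valP b.
  rewrite [val a]surjective_pairing [val b]surjective_pairing xb; congr pair.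
  apply/eqP; rewrite eq_sym -subr_eq0 -sqrf_eq0; apply/eqP.
  have w0' : Q.[x0] = - ((val a).2 *+ 2) by apply/eqP; rewrite -addr_eq0 addrC w0.
  move: ea eb; rewrite xb -/x0 => <-; rewrite w0' => /eqP; rewrite -subr_eq0 => /eqP <-; ring.
rewrite (_ : Some a == infty P Q = false) // eqxx mul0rn sub0r.
have [ut [z z0 zE]] := uniformizer_at_infty monicP degP degQ.
apply: (has_order_intro degP degQ ut).
set v := y / x ^+ g.+1 in ut zE *.
have -> : ff ('X - x0%:P) / v ^ (- (1%R *+ 2)) = 
    eval_chart g (infty P Q) (((1 - x0 *: 'X)%:P) * z).
  rewrite -invr_expz invrK -[v ^ _]/(v ^+ 2) zE rmorphM /= mulrA; congr (_ * _).
  rewrite eval_chart_infty rmorphB /= mulrBl divrr ?ffx_unit //.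
  have -> : map_poly (ffconst P Q) (1 - x0 *: 'X) = 1 - (ffconst P Q x0)%:P * 'X.
    by rewrite -mul_polyC rmorphB rmorph1 rmorphM /= map_polyC map_polyX.
  by rewrite !hornerE.
apply: local_unit_eval => //.
by rewrite rmorphM mulf_neq0 //= eval_valE /= !hornerE subr0 oner_neq0.
Qed.

End Orders.

(** * Functions without poles at finite distance *)

Section RegularFunctions.
Context (k : closedFieldType) (g : nat) (P Q : {poly k}).
Hypothesis (degP : size P = g.*2.+2) (degQ : (size Q <= g.+1)%N).
Local Notation K := (funfield P Q).
Local Notation ff := (ffpoly P Q).
Local Notation y := (ffy P Q).
Local Notation x := (ffx P Q).
Local Notation pt := (point P Q).

Lemma quadratic_split (b c : k) : exists u v : k,
  'X^2 + b%:P * 'X - c%:P = ('X - u%:P) * ('X - v%:P).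
Proof.
have [r rE] := closed_field_poly_normal ('X^2 + b%:P * 'X - c%:P).
have /eqP lc : lead_coef ('X^2 + b%:P * 'X - c%:P) == 1 by rewrite -monicE monic_quadratic.
rewrite lc scale1r in rE; have := size_quadratic b c.
rewrite rE size_prod_XsubC => -[]; case: r rE => [|u [|v []]] // rE _.
by exists u, v; rewrite !big_cons big_nil mulr1.
Qed.

(** Reduce D f = A + B y modulo x - x1: the polynomial A(x1) + B(x1) y, times a
    factor that is a unit at a point over x1, is divisible by the equation of the
    fiber.  Using this at all points over x1, it is itself divisible by that quadratic
    equation, hence is 0. *)
Lemma pole_free_fiber (f : K) (D A B : {poly k}) (x1 : k) :
    (forall a : affine_point P Q, regular_at g (Some a : pt) f) ->
    ff D * f = ff A + ff B * y -> root D x1 -> root A x1 /\ root B x1.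
Proof.
move=> rf fE Dx1.
pose c : {poly k} := 'X^2 + Q.[x1]%:P * 'X - P.[x1]%:P.
pose l : {poly k} := A.[x1]%:P + B.[x1]%:P * 'X.
suff l0 : l = 0.
  have [] : A.[x1] = 0 /\ B.[x1] = 0 by apply: linear_poly_eq0; rewrite addrC.
  by rewrite /root => -> ->.
pose sp : {rmorphism {poly {poly k}} -> {poly k}} := map_poly (horner_eval x1).
have spC p : sp p%:P = p.[x1]%:P by rewrite /sp /= map_polyC.
have spX : sp 'X = 'X by rewrite /sp /= map_polyX.
have loc y1 : root c y1 -> exists2 b1 : {poly k}, ~~ root b1 y1 & c %| l * b1.
  rewrite /root /c !hornerE => /eqP cy.
  have ay : y1 ^+ 2 + Q.[x1] * y1 == P.[x1] by rewrite -subr_eq0 cy.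
  have [u [b [b0 fb]]] := rf (exist _ (x1, y1) ay).
  exists (sp b).
    apply: contra b0; rewrite eval_valE /= /root => /eqP E.
    rewrite -[_.[x1]]/(horner_eval x1 _) -horner_map /= /horner_eval hornerC -/(sp b) E //.
  have : ffeval P Q ((A%:P + B%:P * 'X) * b - D%:P * u) = 0.
    rewrite ffeval_linear_relation -fE.
    by rewrite -!(eval_chart_affine g (exist _ (x1, y1) ay)) -fb mulrA subrr.
  move=> /ffeval_eq0[q qE]; have := congr1 sp qE.
  rewrite rmorphB !rmorphM rmorphD rmorphM spX !spC (eqP Dx1) mul0r subr0 -/l => ->.
  rewrite /plane_curve (expr2 'X) rmorphB rmorphD !rmorphM spX !spC -expr2 -/c.
  exact: dvdp_mull.
have [y1 [y2 cE]] := quadratic_split Q.[x1] P.[x1]; rewrite -/c in cE.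
have sl : (size l <= 2)%N.
  rewrite /l addrC size_MXaddC; case: ifP => // _.
  by rewrite ltnS size_polyC; case: (_ != 0).
suff dvd : c %| l.
  apply/eqP; apply: contraTT dvd => l0; apply/negP => /(dvdp_leq l0).
  by rewrite size_quadratic leqNgt ltnS sl.
have cop (b : {poly k}) z : ~~ root b z -> coprimep ('X - z%:P) b.
  by move=> nr; rewrite coprimep_sym coprimep_XsubC.
have [b1 nb1 d1] : exists2 b1 : {poly k}, ~~ root b1 y1 & c %| l * b1.
  by apply: loc; rewrite cE rootM root_XsubC eqxx.
have [y12|y12] := eqVneq y1 y2.
  by move: d1; rewrite cE -y12 Gauss_dvdpl // coprimepMl !cop.
have [b2 nb2 d2] : exists2 b2 : {poly k}, ~~ root b2 y2 & c %| l * b2.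
  by apply: loc; rewrite cE rootM !root_XsubC eqxx orbT.
rewrite cE Gauss_dvdp; last by apply: cop; rewrite root_XsubC.
apply/andP; split.
  by rewrite -(Gauss_dvdpl _ (cop _ _ nb1)) (dvdp_trans _ d1) // cE dvdp_mulr.
by rewrite -(Gauss_dvdpl _ (cop _ _ nb2)) (dvdp_trans _ d2) // cE dvdp_mull.
Qed.

(** The coordinate ring is the intersection of the local rings at its points:
    remove the roots of a denominator one at a time. *)
Lemma regular_affine_poly (f : K) :
    (forall a : affine_point P Q, regular_at g (Some a : pt) f) ->
  exists A B, f = ff A + ff B * y.
Proof.
move=> rf; have [D [A [B [D0 fE]]]] := funfield_decomp f.
have [n] := ubnP (size D); elim: n D A B D0 fE => // n IHn D A B D0 fE ltD.
have [sD|sD] := leqP (size D) 1.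
  have [d d0 DE] : exists2 d, d != 0 & D = d%:P.
    by exists D`_0; [rewrite -polyC_eq0 -(size1_polyC sD)|exact: size1_polyC].
  exists (d^-1%:P * A), (d^-1%:P * B).
  have <- : ff d^-1%:P * (ff D * f) = f.
    by rewrite mulrA DE -!rmorphM mulVf // !rmorph1 mul1r.
  by rewrite fE mulrDr mulrA !ffpolyM.
(* k is algebraically closed, and D is not constant. *)
have [x1 Dx1] : exists x1, root D x1.
  by apply/closed_rootP; rewrite neq_ltn sD orbT.
have [/factor_theorem[A' AE] /factor_theorem[B' BE]] := pole_free_fiber rf fE Dx1.
have /factor_theorem[D' DE] := Dx1.
have X0 : 'X - x1%:P != 0 :> {poly k} by rewrite polyXsubC_eq0.
have D'0 : D' != 0 by apply: contraNneq D0 => D'0; rewrite DE D'0 mul0r.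
apply: (IHn D' A' B' D'0); last first.
  by move: ltD; rewrite DE size_mul // size_XsubC addn2.
apply: (mulrI (ffpoly_unit P Q X0)).
transitivity (ff D * f); first by rewrite DE ffpolyM mulrCA mulrA.
by rewrite fE AE BE !ffpolyM mulrDr [ff A' * _]mulrC [ff B' * _]mulrC mulrA.
Qed.

End RegularFunctions.

(** * Poles at infinity *)

Section Infinity.
Context (k : fieldType) (g : nat) (P Q : {poly k}).
Hypothesis (monicP : P \is monic) (degP : size P = g.*2.+2) (degQ : (size Q <= g.+1)%N).
Local Notation K := (funfield P Q).
Local Notation ff := (ffpoly P Q).
Local Notation y := (ffy P Q).
Local Notation x := (ffx P Q).
Local Notation v := (y / x ^+ g.+1).
Local Notation ev := (eval_chart g (infty P Q)).
Local Notation va := (eval_val (infty P Q)).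

Let evM a b : ev (a * b) = ev a * ev b. Proof. exact: rmorphM. Qed.
Let evD a b : ev (a + b) = ev a + ev b. Proof. exact: rmorphD. Qed.
Let evXn a n : ev (a ^+ n) = ev a ^+ n. Proof. exact: rmorphXn. Qed.
Let evX : ev 'X = v. Proof. exact: eval_chartX. Qed.
Let vaM a b : va (a * b) = va a * va b. Proof. exact: rmorphM. Qed.
Let vaD a b : va (a + b) = va a + va b. Proof. exact: rmorphD. Qed.
Let vaXn a n : va (a ^+ n) = va a ^+ n. Proof. exact: rmorphXn. Qed.
Let vaX : va 'X = 0. Proof. by rewrite eval_valE /= hornerX horner0. Qed.

Lemma ffpoly_at_infty (A : {poly k}) :
  ff A = ev (rev_poly (size A).-1 A)%:P * x ^+ (size A).-1.
Proof.
rewrite eval_chart_infty rev_poly_horner ?horner_ffx ?ffx_unit //.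
exact: leqSpred.
Qed.

Lemma rev_poly_val (A : {poly k}) : va (rev_poly (size A).-1 A)%:P = lead_coef A.
Proof. by rewrite eval_valE /= hornerC horner_coef0 coef_poly subn0. Qed.

(** At infinity x has a pole of order 2: x v^2 is regular, and z represents it. *)
Lemma pole_order_abscissa (z : {poly {poly k}}) (A : {poly k}) :
  x * v ^+ 2 = ev z ->
  ff A * v ^+ (size A).-1.*2 = ev ((rev_poly (size A).-1 A)%:P * z ^+ (size A).-1).
Proof.
move=> zE; rewrite evM evXn -zE {1}ffpoly_at_infty -mulrA; congr (_ * _).
by move: v => w; rewrite exprMn -exprM mul2n.
Qed.

(** At infinity y = x^(g+1) v has a pole of order 2g + 1. *)
Lemma pole_order_ordinate (z : {poly {poly k}}) (B : {poly k}) :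
  x * v ^+ 2 = ev z ->
  ff B * y * v ^+ ((size B).-1.*2 + g.*2.+1) =
    ev ((rev_poly (size B).-1 B)%:P * z ^+ ((size B).-1 + g.+1)).
Proof.
move=> zE; rewrite evM evXn -zE {1}ffpoly_at_infty -!mulrA; congr (_ * _).
have vE : x ^+ g.+1 * v = y by rewrite mulrC divrK // unitrX ?ffx_unit.
move: v vE => w vE; rewrite exprMn -exprM.
rewrite -{1}vE (exprD x).
have -> : (2 * ((size B).-1 + g.+1) = ((size B).-1.*2 + g.*2.+1).+1)%N by lia.
by rewrite (exprS w) !mulrA.
Qed.

(** The pole orders of A(x) and of B(x) y have different parities, so the leading
    terms cannot cancel. *)
Lemma pole_order_infty (A B : {poly k}) : (A != 0) || (B != 0) ->
  exists d e, [/\ va e != 0, (ff A + ff B * y) * v ^+ d = ev e,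
     A != 0 -> ((size A).-1.*2 <= d)%N & B != 0 -> ((size B).-1.*2 + g.*2.+1 <= d)%N].
Proof.
have [_ [z z0 zE]] := uniformizer_at_infty monicP degP degQ.
(* z comes from v^2 = u z with u = 1/x. *)
have {}zE : x * v ^+ 2 = ev z by rewrite zE mulrA divrr ?mul1r ?ffx_unit.
have AE := pole_order_abscissa A zE; have BE := pole_order_ordinate B zE.
set a := (size A).-1.*2 in AE *; set b := ((size B).-1.*2 + g.*2.+1)%N in BE *.
set ea := (_ * _ : {poly {poly k}}) in AE; set eb := (_ * _ : {poly {poly k}}) in BE.
have a0 : A != 0 -> va ea != 0.
  by move=> A0; rewrite /ea vaM vaXn rev_poly_val mulf_neq0 ?expf_neq0 ?lead_coef_eq0.
have b0 : B != 0 -> va eb != 0.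
  by move=> B0; rewrite /eb vaM vaXn rev_poly_val mulf_neq0 ?expf_neq0 ?lead_coef_eq0.
have [B00|Bn0] := eqVneq B 0.
  rewrite orbF => A0; exists a, ea; split=> //; first exact: a0.
  by rewrite B00 rmorph0 mul0r addr0.
have [A00|An0 _] := eqVneq A 0.
  by move=> _; exists b, eb; split=> //; [exact: b0|rewrite A00 rmorph0 add0r].
have [ab|ba|ab] := ltngtP a b; last by move: ab; rewrite /a /b; lia.
  exists b, (ea * 'X ^+ (b - a) + eb); split=> //; last by rewrite ltnW.
    by rewrite vaD vaM vaXn vaX expr0n subn_eq0 leqNgt ab /= mulr0 add0r b0.
  rewrite evD evM evXn evX -AE -BE mulrDl; congr (_ + _).
  by rewrite -mulrA -exprD subnKC // ltnW.
exists a, (ea + eb * 'X ^+ (a - b)); split=> //; last by rewrite ltnW.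
  by rewrite vaD vaM vaXn vaX expr0n subn_eq0 leqNgt ba /= mulr0 addr0 a0.
rewrite evD evM evXn evX -AE -BE mulrDl; congr (_ + _).
by rewrite -[RHS]mulrA -exprD subnKC // ltnW.
Qed.

Lemma degree_bounds_infty (A B : {poly k}) N :
    regular_at g (infty P Q) ((ff A + ff B * y) * v ^+ N) ->
  (A != 0 -> ((size A).-1.*2 <= N)%N) /\ (B != 0 -> ((size B).-1.*2 + g.*2.+1 <= N)%N).
Proof.
move=> [a [b [b0 E]]].
have [/norP[/negbNE A0 /negbNE B0]|nz] := boolP (~~ ((A != 0) || (B != 0))).
  by rewrite A0 B0.
have [d [e [e0 eE dA dB]]] := pole_order_infty (negbNE nz).
suff led : (d <= N)%N by split=> [/dA|/dB] /leq_trans; apply.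
rewrite leqNgt; apply/negP => ltN.
have := ev_eq (chart_kernel degP degQ (xi := infty P Q)) (a := e * b) (b := a * 'X ^+ (d - N)).
rewrite /= !vaM vaXn vaX expr0n subn_eq0 leqNgt ltN /= mulr0 => E'.
have /E'/eqP : ev (e * b) = ev (a * 'X ^+ (d - N)).
  rewrite !evM evXn evX -eE -E -(subnKC (ltnW ltN)) exprD addKn.
  by rewrite !mulrA [LHS]mulrAC.
by rewrite mulf_eq0 (negPf e0) (negPf b0).
Qed.

End Infinity.

(** * From a vanishing function to a factor of Delta *)

Section LocalRelation.
Context (k : fieldType) (P Q : {poly k}) (x0 y0 : k).

(** A + B y vanishes to order N at (x0, y0), written in k[x, y]: it is
    (x - x0)^N a / b modulo the equation of the curve, with b(x0, y0) <> 0. *)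
Definition vanishing_relation (N : nat) (A B : {poly k}) :=
  exists a b q : {poly {poly k}}, eval2 id x0 y0 b != 0 /\
    (A%:P + B%:P * 'X) * b = (('X - x0%:P) ^+ N)%:P * a + q * plane_curve P Q.

(** Substitute x = x0 + t and y = h: the equation becomes 0 modulo t^M, and b becomes
    prime to t. *)
Lemma vanishing_relation_dvd N M A B (h : {poly k}) :
    vanishing_relation N A B -> (N <= M)%N -> h.[0] = y0 ->
    'X^M %| h ^+ 2 + (Q \Po ('X + x0%:P)) * h - (P \Po ('X + x0%:P)) ->
  'X^N %| (A \Po ('X + x0%:P)) + (B \Po ('X + x0%:P)) * h.
Proof.
move=> [a [b [q [b0 E]]]] leNM h0 hM.
pose phi : {rmorphism {poly {poly k}} -> {poly k}} :=
  horner_eval h \o map_poly (comp_poly ('X + x0%:P)).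
have phiC p : phi p%:P = p \Po ('X + x0%:P).
  by rewrite /phi /= map_polyC /= /horner_eval hornerC.
have phiX : phi 'X = h by rewrite /phi /= map_polyX /horner_eval hornerX.
have phi0 : (phi b).[0] = eval2 id x0 y0 b.
  rewrite /phi /= /horner_eval -h0 -!/(horner_eval _ _) -horner_map /=.
  rewrite -map_poly_comp /eval2; congr (_.[_]); apply: eq_map_poly => c /=.
  by rewrite /horner_eval horner_comp map_polyE map_id polyseqK !hornerE.
clearbody phi; have := congr1 phi E.
rewrite rmorphM !rmorphD !rmorphM /= phiX !phiC.
rewrite (rmorphXn (comp_poly _)) /= comp_polyB comp_polyX comp_polyC addrK.
have -> : phi (plane_curve P Q) = h ^+ 2 + (Q \Po ('X + x0%:P)) * h - (P \Po ('X + x0%:P)).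
  by rewrite /plane_curve expr2 rmorphB rmorphD !rmorphM phiX !phiC -expr2.
move=> E'; rewrite -(@Gauss_dvdpl _ _ (phi b)).
  rewrite E'; apply: dvdp_add; first exact: dvdp_mulr.
  by apply: dvdp_mull; apply: dvdp_trans hM; rewrite dvdp_exp2l.
rewrite coprimep_expl // -['X]subr0 coprimep_sym coprimep_XsubC.
by rewrite /root phi0.
Qed.

End LocalRelation.

Section DivisibilityOfDelta.
Context (k : fieldType) (g : nat) (P Q : {poly k}).
Hypothesis (monicP : P \is monic) (degP : size P = g.*2.+2) (degQ : (size Q <= g.+1)%N).

(** The first case collects the default values: when there is no D_1 all numerators
    vanish, and so does Delta_N; it also vanishes when F^(mu(mu+1)/2) does not divide
    Gamma_N. *)
Lemma Delta_eq N :
  Delta g P Q N = 0 \/ (exists D, is_D1 (g := g) D) /\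
  Delta g P Q N * (P *+ 4 + Q ^+ 2) ^+ (mu g N * (mu g N).+1)./2 =
    \det (\matrix_(i < (mu g N).+1, j < (mu g N).+1)
             map_poly (@specialize g k P Q) (s_ g i (nu N + j))).
Proof.
have [exD|noD] := pselect (exists D, is_D1 (g := g) D); last first.
  left; rewrite /Delta /Delta_gen; case: xgetP => [D _ /= DE|_]; last by rewrite rmorph0.
  have G0 : Gam g N = 0.
    rewrite /Gam [X in \det X](_ : _ = 0) ?det0 //.
    by apply/matrixP => i j; rewrite !mxE s_eq0.
  move/eqP: DE; rewrite G0 mulf_eq0 expf_eq0 (negPf (genF_neq0 g)) andbF orbF => /eqP ->.
  by rewrite rmorph0.
rewrite /Delta /Delta_gen; case: xgetP => [D _ /= DE|_]; last by left; rewrite rmorph0.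
right; split=> //; have := congr1 (map_poly (@specialize g k P Q)) DE.
rewrite rmorphM rmorphXn /= rmorphD rmorphMn rmorphXn /=.
rewrite (specialize_genP _ monicP degP) (specialize_genQ _ degQ) => ->.
rewrite /Gam -det_map_mx; congr (\det _); by apply/matrixP => i j; rewrite !mxE.
Qed.
(** The entries of the matrix are specialized numerators, and B (x - x0)^j provides
    the relations for [dvdp_det_relations]: nu + mu = N + r - g translates the order
    N + j - n into the distance of the column from the last one. *)
Lemma dvdp_Delta (N r : nat) (x0 y0 : k) (A B : {poly k}) :
    (g.*2.+1 <= N)%N ->
    y0 ^+ 2 + Q.[x0] * y0 = P.[x0] -> y0 *+ 2 + Q.[x0] != 0 ->
    (size A <= N./2.+1)%N -> B != 0 -> (size B <= (mu g N).+1)%N ->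
    vanishing_relation P Q x0 y0 N A B ->
  ('X - x0%:P) ^+ eps r g %| Delta g P Q (N + r).
Proof.
move=> leN E0 w0 sA B0 sB rel.
have [->|[exD DE]] := Delta_eq (N + r); first exact: dvdp0.
have rootF : ~~ root (P *+ 4 + Q ^+ 2) x0.
  rewrite /root hornerD hornerMn horner_exp -E0.
  have -> : (y0 ^+ 2 + Q.[x0] * y0) *+ 4 + Q.[x0] ^+ 2 = (y0 *+ 2 + Q.[x0]) ^+ 2 by ring.
  by rewrite expf_eq0.
set e := (mu g (N + r) * _)./2 in DE.
rewrite -(@Gauss_dvdpl _ _ ((P *+ 4 + Q ^+ 2) ^+ e)); last first.
  by rewrite coprimep_expl // coprimep_expr // coprimep_sym coprimep_XsubC.
rewrite DE; have [h h0 hM] : exists2 h : {poly k}, h.[0] = y0 &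
    'X^(N + r) %| h ^+ 2 + (Q \Po ('X + x0%:P)) * h - (P \Po ('X + x0%:P)).
  by apply: hensel_quadratic; rewrite !horner_comp !hornerE.
have hAB := vanishing_relation_dvd rel (leq_addr r N) h0 hM.
apply: (@dvdp_det_relations _ _ _ B ('X - x0%:P)) => [//|||j c].
- exact: size_XsubC.
- by move: sB; rewrite /mu; lia.
under eq_bigr => l _ do rewrite mxE.
have sX i : size (('X - x0%:P : {poly k}) ^+ i) = i.+1 by rewrite size_exp_XsubC.
have Xn0 i : ('X - x0%:P : {poly k}) ^+ i != 0 by rewrite -size_poly_eq0 sX.
have ltj := ltn_ord j; have ltc := ltn_ord c.
have sb : (size (B * ('X - x0%:P) ^+ j)%R <= (mu g (N + r)).+1)%N.
  by rewrite (leq_trans (size_polyMleq _ _)) // sX; move: sB; rewrite /mu; lia.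
have [q qE] := @hasse_num_specialize k g P Q monicP degP degQ (B * ('X - x0%:P) ^+ j) _ 
   (nu (N + r) + c) exD sb (ltac:(rewrite /mu /nu; lia)).
have := @hasse_num_vanish k P Q x0 (A * ('X - x0%:P) ^+ j) _ _ h q (N + j) _ _ _ _ _ qE.
have -> : (N + j - (nu (N + r) + c) = g + j + ((mu g (N + r)).+1.-1 - c) - r)%N.
  by rewrite /mu /nu; move: ltj ltc; rewrite /mu /=; lia.
apply.
- by apply: dvdp_trans hM; rewrite dvdp_exp2l // leq_add2l; lia.
- rewrite !comp_polyM (rmorphXn (comp_poly _)) /= comp_polyB comp_polyX comp_polyC addrK.
  by rewrite mulrAC -mulrDl exprD dvdp_mul.
- by rewrite (leq_trans (size_polyMleq _ _)) // sX; move: sA; rewrite /nu; lia.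
by rewrite (leq_trans sb) // /mu /nu; lia.
Qed.
End DivisibilityOfDelta.

(** * The function attached to a torsion point *)

Section TorsionRelation.
Context (k : closedFieldType) (g : nat) (P Q : {poly k}) (N : nat).
Hypothesis (monicP : P \is monic) (degP : size P = g.*2.+2) (degQ : (size Q <= g.+1)%N).
Hypothesis (smoothPQ : smooth_affine P Q).
Hypothesis (leN : (g.*2.+1 <= N)%N).
Local Notation K := (funfield P Q).
Local Notation ff := (ffpoly P Q).
Local Notation y := (ffy P Q).
Local Notation x := (ffx P Q).
Local Notation pt := (point P Q).

(** x - x0 is a uniformizer at (x0, y0), so A vanishes to order N at x0. *)
Lemma vanishing_relation_size A (x0 y0 : k) :
    y0 ^+ 2 + Q.[x0] * y0 = P.[x0] -> y0 *+ 2 + Q.[x0] != 0 ->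
    vanishing_relation P Q x0 y0 N A 0 -> A != 0 -> (N < size A)%N.
Proof.
move=> E0 w0 rel A0.
have [h h0 hM] : exists2 h : {poly k}, h.[0] = y0 &
    'X^N %| h ^+ 2 + (Q \Po ('X + x0%:P)) * h - (P \Po ('X + x0%:P)).
  by apply: hensel_quadratic; rewrite !horner_comp !hornerE.
have := vanishing_relation_dvd rel (leqnn N) h0 hM.
rewrite comp_poly0 mul0r addr0 => /dvdp_leq.
have -> : size (A \Po ('X + x0%:P)) = size A.
  by rewrite size_comp_poly2 // size_XaddC.
rewrite size_polyXn; apply.
by rewrite -size_poly_eq0 size_comp_poly2 ?size_XaddC // size_poly_eq0.
Qed.

Lemma torsion_relation (x0 : k) : T_tilde g P Q N x0 ->
  exists (y0 : k) (A B : {poly k}),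
  [/\ y0 ^+ 2 + Q.[x0] * y0 = P.[x0], y0 *+ 2 + Q.[x0] != 0,
      (size A <= N./2.+1)%N, B != 0 /\ (size B <= (mu g N).+1)%N &
      vanishing_relation P Q x0 y0 N A B].
Proof.
move=> Tx0; have [y0 [y1 cE]] := quadratic_split Q.[x0] P.[x0].
have E0 : y0 ^+ 2 + Q.[x0] * y0 = P.[x0].
  have := congr1 (horner^~ y0) cE; rewrite !hornerE subrr mul0r => /eqP.
  by rewrite subr_eq0 => /eqP.
have ay : (x0, y0).2 ^+ 2 + Q.[(x0, y0).1] * (x0, y0).2 == P.[(x0, y0).1] by apply/eqP.
pose a : affine_point P Q := exist _ (x0, y0) ay.
have [tN t2] := Tx0 a erefl.
have w0 : y0 *+ 2 + Q.[x0] != 0.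
  apply/eqP => w0; apply: t2.
  exact: (two_torsion_of_ramified monicP degP degQ smoothPQ (a := a) w0).
have [f uf fo] := (torsionP g (Some a : pt) N).1 tN.
have ut := uniformizer_of_abscissa degP degQ (a := a) w0.
rewrite -[(val a).1]/x0 in ut.
have ffXn : ff (('X - x0%:P) ^+ N) = ff ('X - x0%:P) ^+ N by exact: (rmorphXn ff).
have fa : local_unit g (Some a : pt) (f / ff ('X - x0%:P) ^+ N).
  have := fo (Some a) _ ut.
  by rewrite eqxx (_ : infty P Q == Some a = false) // mul0rn subr0 natz -exprnP.
(* At a the order is N >= 0; at the other affine points it is 0. *)
have rf (b : affine_point P Q) : regular_at g (Some b : pt) f.
  have [ab|ab] := eqVneq (Some a : pt) (Some b).
    rewrite -ab; rewrite -[f](divrK (unitrX N ut.1)).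
    have [_ rfa _] := fa; apply: regular_atM => //.
    rewrite -ffXn -ffevalC -(eval_chart_affine g a).
    exact: regular_at_eval.
  have := fo (Some b); rewrite (negPf ab) (_ : infty P Q == Some b = false) // !mul0rn subr0.
  by move/(has_order0 monicP degP degQ smoothPQ) => [].
have [A [B fE]] := regular_affine_poly rf.
have [uv _] := uniformizer_at_infty monicP degP degQ.
have := fo (infty P Q) _ uv; rewrite (_ : Some a == infty P Q = false) // eqxx mul0rn sub0r.
rewrite -invr_expz invrK fE natz -exprnP => -[_ + _].
case/(degree_bounds_infty monicP degP degQ) => dA dB.
have rel : vanishing_relation P Q x0 y0 N A B.
  have [_ [u [b [b0 ub]]] _] := fa; exists u, b.
  have : ffeval P Q ((A%:P + B%:P * 'X) * b - (('X - x0%:P) ^+ N)%:P * u) = 0.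
    rewrite ffeval_linear_relation -fE -!(eval_chart_affine g a) -ub.
    by rewrite ffXn mulrA [_ * (f / _)]mulrC divrK ?subrr // unitrX // ut.1.
  move=> /ffeval_eq0[q qE]; exists q; split; first exact: b0.
  by rewrite -qE [RHS]addrC subrK.
have sA : (size A <= N./2.+1)%N.
  have [->|A0] := eqVneq A 0; first by rewrite size_poly0.
  by move: (dA A0); move: (size A) => n; lia.
exists y0, A, B; split=> //; split.
  apply: contraTneq sA => B0; rewrite B0 in rel fE.
  have A0 : A != 0.
    apply: contraTneq uf => A0; rewrite fE A0 !rmorph0 mul0r addr0 unitr0 //.
  by move: (vanishing_relation_size E0 w0 rel A0); move: (size A) => n; lia.
have [->|B0] := eqVneq B 0; first by rewrite size_poly0.
by move: (dB B0); rewrite /mu; move: (size B) => n; lia.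
Qed.

End TorsionRelation.

Theorem proposition1p5 (k : closedFieldType) (g : nat) (P Q : {poly k})
    (N r : nat) (g_gt0 : (1 <= g)%N)
    (monicP : P \is monic) (degP : size P = g.*2.+2)
    (degQ : (size Q <= g.+1)%N) (smoothPQ : smooth_affine P Q)
    (leN : (g.*2.+1 <= N)%N) (ler : (r <= g.*2 - 2)%N) :
  U_tilde g P Q N ^+ eps r g %| Delta g P Q (N + r).
Proof.
apply: dvdp_prod_XsubC_exp; first exact: finite_support_uniq.
move=> x0; case: finite_supportP => [//|T ssub _ _] xT.
have [y0 [A [B [E0 w0 sA [B0 sB] rel]]]] :=
  torsion_relation monicP degP degQ smoothPQ leN (ssub _ xT).
exact: (dvdp_Delta monicP degP degQ _ leN E0 w0 sA B0 sB rel).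
Qed.
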